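(* Let $0<p<2$. Let $(\Omega,\mathcal{H},\hat{\mathbb{E}})$ be a sub-linear expectation space with upper capacity $\mathbb{V}$ and conjugate expectation $\hat{\varepsilon}[\cdot]$, and let $\{X;X_n,n\geq1\}\subset\mathcal{H}$ be identically distributed random variables (each $X_n$ identically distributed with $X$), with $\{X_n,n\geq1\}$ extended negatively dependent (END). Assume further that, if $p\geq1$, $\hat{\mathbb{E}}[X]=0$ and $\lim_{c\to\infty}\hat{\mathbb{E}}[(|X|^{p}-c)_+]=0$. Let $l(x)$ be a slowly varying function and let $\{a_{ni},1\leq i\leq n,n\geq1\}$ be an array of nonnegative real numbers satisfying $\sum_{i=1}^{n}a_{ni}^{q}=O(n)$ for some $q>p$. If $C_{\mathbb{V}}\left[|X|^{p}l(|X|^{p})\right]<\infty$, then for any real number $\varepsilon>0$, $$\sum_{n=1}^{\infty}n^{-1}l(n)\,\mathbb{V}\left(\sum_{i=1}^{n}a_{ni}X_i>\varepsilon n^{1/p}\right)<\infty.$$ If it is further assumed that $\hat{\varepsilon}[X]=0$ when $p\geq1$, then for any $\varepsilon>0$, $$\sum_{n=1}^{\infty}n^{-1}l(n)\,\mathbb{V}\left(\left|\sum_{i=1}^{n}a_{ni}X_i\right|>\varepsilon n^{1/p}\right)<\infty.$$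
   Context: Setting. $(\Omega,\mathcal{F})$ is a measurable space and $\mathcal{H}$ is a linear space of real functions on $(\Omega,\mathcal{F})$ (called random variables) such that $X_1,\dots,X_n\in\mathcal{H}$ implies $\varphi(X_1,\dots,X_n)\in\mathcal{H}$ for each $\varphi\in C_{l,Lip}(\mathbb{R}^n)$, where $C_{l,Lip}(\mathbb{R}^n)$ is the space of functions $\varphi$ with $|\varphi(x)-\varphi(y)|\leq C(1+|x|^m+|y|^m)|x-y|$ for all $x,y\in\mathbb{R}^n$, for some $C>0$, $m\in\mathbb{N}$ depending on $\varphi$. $C_{b,Lip}(\mathbb{R}^n)$ is the space of functions with $|\varphi(x)|\leq C$ and $|\varphi(x)-\varphi(y)|\leq C|x-y|$ for all $x,y$, for some $C>0$ depending on $\varphi$. Sub-linear expectation. $\hat{\mathbb{E}}:\mathcal{H}\to[-\infty,+\infty]$ satisfies, for all $X,Y\in\mathcal{H}$: (a) $X\geq Y$ implies $\hat{\mathbb{E}}[X]\geq\hat{\mathbb{E}}[Y]$; (b) $\hat{\mathbb{E}}[c]=c$ for constants $c$; (c) $\hat{\mathbb{E}}[X+Y]\leq\hat{\mathbb{E}}[X]+\hat{\mathbb{E}}[Y]$ whenever the right side is not of the form $+\infty-\infty$ or $-\infty+\infty$; (d) $\hat{\mathbb{E}}[\lambda X]=\lambda\hat{\mathbb{E}}[X]$ for $\lambda>0$. The triple $(\Omega,\mathcal{H},\hat{\mathbb{E}})$ is a sub-linear expectation space. The conjugate expectation is $\hat{\varepsilon}[X]:=-\hat{\mathbb{E}}[-X]$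 (not to be confused with the real number $\varepsilon$). Identical distribution. $X,Y\in\mathcal{H}$ are identically distributed if $\hat{\mathbb{E}}[\varphi(X)]=\hat{\mathbb{E}}[\varphi(Y)]$ for any $\varphi\in C_{l,Lip}(\mathbb{R})$, whenever the upper expectations are finite. Capacity and Choquet expectation. For $A\in\mathcal{F}$, $\mathbb{V}(A)=\inf\{\hat{\mathbb{E}}[\xi]: I_A\leq\xi,\ \xi\in\mathcal{H}\}$, where $I_A$ is the indicator function of $A$. The Choquet expectation is $C_{\mathbb{V}}[Y]=\int_0^\infty\mathbb{V}(Y\geq t)\,dt+\int_{-\infty}^{0}[\mathbb{V}(Y\geq t)-1]\,dt$. Extended negative dependence. A sequence $\{X_n,n\geq1\}\subset\mathcal{H}$ is upper (resp. lower) extended negatively dependent if there is a dominating constant $K\geq1$ such that $\hat{\mathbb{E}}\left[\prod_{i=1}^{n}f_i(X_i)\right]\leq K\prod_{i=1}^{n}\hat{\mathbb{E}}[f_i(X_i)]$ for all $n\geq1$, whenever the non-negative functions $f_i\in C_{b,Lip}(\mathbb{R})$, $i=1,2,\dots$, are all non-decreasing (resp. all non-increasing). The sequence is END if it is both upper and lower extended negatively dependent. Slow variation. A real valued function $l(x)$, positive and measurable on $\mathbb{R}^+$, is slowly varying if $\lim_{x\to\infty}l(\lambda x)/l(x)=1$ for each $\lambda>0$. Notation: $x_+=x$ if $x>0$ and $x_+=0$ otherwise; $a_n=O(b_n)$ means there is a constant $C>0$ not depending on $n$ with $a_n\leq Cb_n$ for all $n\geq1$. *)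

(* Defs.v *)
From HB Require Import structures.
From mathcomp Require Import all_boot all_order all_algebra.
From mathcomp Require Import all_classical all_reals all_analysis.

Set Implicit Arguments.
Unset Strict Implicit.
Unset Printing Implicit Defensive.

Import Order.TTheory GRing.Theory Num.Theory.
Import numFieldNormedType.Exports.

Local Open Scope classical_set_scope.
Local Open Scope ring_scope.

(* V is 'rV[R]_n or R.  The library norm of 'rV[R]_n is the sup norm; as all
   norms on R^n are equivalent, the choice of the norm does not affect this
   class (it only changes C). *)
Definition C_l_Lip (R : realType) (V : normedModType R) (phi : V -> R) : Prop :=
  exists2 C : R, 0 < C & exists m : nat, forall x y : V,
    `|phi x - phi y| <= C * (1 + `|x| ^+ m + `|y| ^+ m) * `|x - y|.

Definition C_b_Lip (R : realType) (phi : R -> R) : Prop :=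
  exists2 C : R, 0 < C &
    (forall x, `|phi x| <= C) /\
    (forall x y, `|phi x - phi y| <= C * `|x - y|).

Record random_variable_space (d : measure_display) (Omega : measurableType d)
    (R : realType) (H : set (Omega -> R)) : Prop := RandomVariableSpace {
  rvs_measurable : forall X, H X -> measurable_fun [set: Omega] X ;
  rvs_zero : H (fun=> 0) ;
  rvs_add : forall X Y, H X -> H Y -> H (fun w => X w + Y w) ;
  rvs_scale : forall (c : R) X, H X -> H (fun w => c * X w) ;
  rvs_comp : forall (n : nat) (X : 'I_n -> Omega -> R) (phi : 'rV[R]_n -> R),
    (forall i, H (X i)) -> C_l_Lip phi -> H (fun w => phi (\row_i X i w))
}.

Section SublinearExpectation.
Variables (d : measure_display) (Omega : measurableType d) (R : realType).
Variables (H : set (Omega -> R)) (E : (Omega -> R) -> \bar R).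
Local Open Scope ereal_scope.

(* E is only specified on H; its values outside H are irrelevant.
   E X +? E Y says that the sum is not of the form oo - oo. *)
Record sublinear_expectation : Prop := SublinearExpectation {
  sle_mono : forall X Y, H X -> H Y ->
    (forall w, (Y w <= X w)%R) -> E Y <= E X ;
  sle_cst : forall c : R, E (fun=> c) = c%:E ;
  sle_subadd : forall X Y, H X -> H Y ->
    E X +? E Y -> E (fun w => X w + Y w)%R <= E X + E Y ;
  sle_scale : forall (c : R) X, H X -> (0 < c)%R ->
    E (fun w => c * X w)%R = c%:E * E X
}.

Definition conj_expectation (X : Omega -> R) : \bar R :=
  - E (fun w => - X w)%R.

Definition identically_distributed (X Y : Omega -> R) : Prop :=
  forall phi : R -> R, C_l_Lip phi ->
    E (phi \o X) \is a fin_num -> E (phi \o Y) \is a fin_num ->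
    E (phi \o X) = E (phi \o Y).

(* Total on sets of outcomes, but meant for measurable sets only. *)
Definition capacity (A : set Omega) : \bar R :=
  ereal_inf [set E xi | xi in [set xi | H xi /\ forall w, (\1_A w <= xi w)%R]].

Definition choquet (Y : Omega -> R) : \bar R :=
  \int[@lebesgue_measure R]_(t in `[0%R, +oo[)
    capacity [set w | (t <= Y w)%R] +
  \int[@lebesgue_measure R]_(t in `]-oo, 0%R])
    (capacity [set w | (t <= Y w)%R] - 1).

(* Sequences are indexed from 1: X 0 plays no role. *)
Definition END_ineq (X : nat -> Omega -> R) (mono : (R -> R) -> Prop) : Prop :=
  exists2 K : R, (1 <= K)%R &
    forall f : nat -> R -> R,
      (forall i, (1 <= i)%N ->
        [/\ C_b_Lip (f i), (forall x, (0 <= f i x)%R) & mono (f i)]) ->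
      forall n, (1 <= n)%N ->
        E (fun w => \prod_(1 <= i < n.+1) f i (X i w))%R <=
        K%:E * \prod_(1 <= i < n.+1) E (f i \o X i).

Definition upper_END (X : nat -> Omega -> R) : Prop :=
  END_ineq X (fun g => {homo g : x y / (x <= y)%R}).

Definition lower_END (X : nat -> Omega -> R) : Prop :=
  END_ineq X (fun g => {homo g : x y /~ (x <= y)%R}).

Definition extended_negatively_dependent (X : nat -> Omega -> R) : Prop :=
  upper_END X /\ lower_END X.

End SublinearExpectation.

Definition slowly_varying (R : realType) (l : R -> R) : Prop :=
  [/\ (forall x, 0 < x -> 0 < l x),
      measurable_fun (`]0, +oo[ : set R) l &
      forall lam, 0 < lam -> l (lam * x) / l x @[x --> +oo] --> (1 : R)].

(* Main.v *)
Require Import Defs.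
From HB Require Import structures.
From mathcomp Require Import all_boot all_order all_algebra.
From mathcomp Require Import all_classical all_reals all_analysis.
From mathcomp Require Import measurable_realfun ring lra.

Set Implicit Arguments.
Unset Strict Implicit.
Unset Printing Implicit Defensive.

Import Order.TTheory GRing.Theory Num.Theory.
Import numFieldNormedType.Exports.

Local Open Scope classical_set_scope.
Local Open Scope ring_scope.

(** Write u_n = n^(1/p); q may be lowered so that q <= 1 if p < 1 and q <= 2
    otherwise.  Weighting is harmless because
    min((a|x|/u)^q, 1) <= max(1,a)^q min((|x|/u)^q, 1) and
    sum_i max(1,a_ni)^q = O(n): both the events {a_ni |X_i| > c u_n} and the
    normalised second moments of the a_ni X_i clipped at level c u_n are
    controlled by n w_n, where w_n bounds the (outer) expectation of
    min((|X|/u_n)^q, 1).  If p < 1, Markov's inequality then gives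
    V(sum_i a_ni X_i > eps u_n) = O(n w_n).  If p >= 1, the centring and the
    uniform integrability make the sum of the clipped means o(u_n), and a
    Chernoff bound, the only place where negative dependence is used, again
    gives O(n w_n).  It remains to see that sum_n l(n) w_n is finite: along
    dyadic n = 2^k one has w_(k+1) <= 2^(-q/p) w_k + V(|X|^p >= 2^k), while the
    weights 2^k l(2^k) grow by a factor tending to 2 < 2^(q/p), and
    sum_k 2^k l(2^k) V(|X|^p >= 2^k) is bounded by the Choquet integral. *)

Lemma cvge0_lt (R : realType) (T : Type) (F : set_system T) (f : T -> \bar R) :
  f x @[x --> F] --> 0%E ->
  forall e : R, 0 < e -> \forall x \near F, (f x < e%:E)%E.
Proof.
move=> f0 e e0; apply: (f0 [set x | (x < e%:E)%E]).
by apply: open_nbhs_nbhs; split; [exact: open_ereal_lt_ereal | rewrite /= lte_fin].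
Qed.

(** * Slowly varying functions *)

(** By uniqueness of Lebesgue measure: [c] times the pushforward of Lebesgue measure along
    multiplication by [c] gives half-open intervals their length. *)
Lemma lebesgue_measure_scale (R : realType) (c : R) (A : set R) : 0 < c ->
  measurable A ->
  lebesgue_measure [set x | A (c * x)] = (c^-1%:E * lebesgue_measure A)%E.
Proof.
move=> c0 mA.
have mc : measurable_fun [set: R] ( *%R c) by exact: mulrl_measurable.
pose f : measurableTypeR R -> measurableTypeR R := *%R c.
have mf : measurable_fun [set: measurableTypeR R] f by [].
pose nu : {measure set (measurableTypeR R) -> \bar R} :=
  mscale (NngNum (ltW c0)) (pushforward lebesgue_measure f).
have E : forall B : set (measurableTypeR R), measurable B ->
    lebesgue_measure B = nu mf B.
  apply: lebesgue_measure_unique => _ [[a b]] _ <-.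
  have pre : f @^-1` `]a, b] = `](a / c), (b / c)]%classic.
    apply/seteqP; split => x /=; rewrite !in_itv /= => /andP[h1 h2];
    apply/andP; split.
    - by rewrite ltr_pdivrMr // mulrC.
    - by rewrite ler_pdivlMr // mulrC.
    - by move: h1; rewrite ltr_pdivrMr // mulrC.
    - by move: h2; rewrite ler_pdivlMr // mulrC.
  transitivity (c%:E * lebesgue_measure (`](a / c)%R, (b / c)%R]%classic : set R))%E.
    rewrite !lebesgue_measure_itv /= !lte_fin ltr_pM2r ?invr_gt0 //.
    case: ifP => _; last by rewrite mule0.
    by rewrite -!EFinD -EFinM -mulrBl mulrCA mulfV ?mulr1 // gt_eqF.
  by rewrite -pre.
rewrite (E _ mA) /nu /= /mscale /= muleA -EFinM mulVf ?gt_eqF // mul1e.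
by [].
Qed.

Section SlowVariation.
Variables (R : realType) (l : R -> R).
Hypothesis hl : slowly_varying l.

(** The window [[1, 4]] contains [s / lam] for all [s] in [[2, 4]] and [lam] in [[1, 2]], so that
    bad sets at two comparable points can be superposed. *)
Definition ratio_off (y : R) : set R :=
  [set s | 1 <= s <= 4 /\ ~ (2^-1 <= l (s * y) / l y <= 2)].

Lemma measurable_ratio_off (y : R) : 0 < y -> measurable (ratio_off y).
Proof.
move=> y0; have [_ ml _] := hl.
have mf : measurable_fun (`[1, 4] : set R) (fun s => l (s * y) / l y).
  apply: measurable_funM => //.
  apply: (@measurable_comp _ _ _ _ _ _ (`]0, +oo[ : set R)) => //.
    move=> z /= [s]; rewrite !in_itv /= andbT => /andP[s1 _] <-.
    by rewrite mulr_gt0 // (lt_le_trans _ s1).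
  exact: measurable_funM.
have -> : ratio_off y = `[1, 4] `\`
    (`[1, 4] `&` (fun s => l (s * y) / l y) @^-1` `[2^-1, 2]).
  apply/seteqP; split => s /=; rewrite !in_itv /=.
    by move=> [h1 h2]; split => // -[].
  by move=> [h1 h2]; split => // h; apply: h2.
by apply: measurableD => //; exact: mf.
Qed.

(** Slow variation is pointwise convergence in [s], so the tail unions [D n] of the bad sets
    decrease to the empty set inside [[1, 4]]. Continuity from above on a set of finite measure
    concludes. *)
Lemma cvg_measure_ratio_off (y : nat -> R) : (forall n, 0 < y n) ->
  y n @[n --> \oo] --> +oo ->
  lebesgue_measure (ratio_off (y n)) @[n --> \oo] --> 0%E.
Proof.
move=> y0 yoo; have [_ _ lim_l] := hl.
pose D n := \bigcup_(i >= n) ratio_off (y i).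
have mD n : measurable (D n).
  by apply: bigcup_measurable => i _; exact: measurable_ratio_off.
have D14 n : D n `<=` `[1, 4].
  by move=> s [i _ [/=]]; rewrite in_itv.
have D0 : \bigcap_n D n = set0.
  rewrite -subset0 => s Ds.
  have s14 : 1 <= s <= 4 by have [i _ []] := Ds 0%N I.
  have s0 : 0 < s by rewrite (lt_le_trans _ (andP s14).1).
  have := (cvg_pinftyP _ _).1 (lim_l _ s0) _ yoo.
  move/cvgr_dist_lt => /(_ 2^-1); rewrite invr_gt0 ltr0n => /(_ isT)[N _ hN].
  have [i /= Ni [_]] := Ds N I; apply.
  have := hN i Ni; rewrite ltr_norml /= => /andP[h1 h2]; lra.
have : lebesgue_measure (D n) @[n --> \oo] --> 0%E.
  rewrite -(measure0 lebesgue_measure) -D0.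
  apply: nonincreasing_cvg_mu => //.
  - apply: (@le_lt_trans _ _ (lebesgue_measure (`[1, 4]%classic : set R))).
      apply: le_measure; [by apply: mem_set; exact: mD | by apply: mem_set |].
      exact: D14.
    by rewrite lebesgue_measure_itv /=; case: ifP => _; rewrite -?EFinD ltry.
  - exact: bigcapT_measurable.
  - move=> m n mn; apply/subsetPset => s [i /= ni h].
    by exists i => //=; exact: leq_trans ni.
apply: squeeze_cvge; last exact: cvg_cst.
  apply: nearW => n; rewrite measure_ge0 /=.
  apply: le_measure; [|by apply: mem_set; exact: mD|].
    by apply: mem_set; exact: measurable_ratio_off.
  by move=> s h; exists n => /=.
Qed.

(* Weak form of the uniform convergence theorem.  If x_n and
   y_n = lam_n x_n were bad, then most points z of [2 x_n, 4 x_n] would have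
   l z close to both l x_n and l y_n. *)
Lemma slowly_varying_ratio_bound :
  exists2 x0 : R, 0 < x0 & forall x lam, x0 <= x -> 1 <= lam <= 2 ->
    l x / 4 <= l (lam * x) <= 4 * l x.
Proof.
have [l_gt0 _ _] := hl.
apply: contrapT => nbnd.
have bad n : exists xl : R * R, [/\ n.+1%:R <= xl.1, 1 <= xl.2 <= 2 &
    ~ (l xl.1 / 4 <= l (xl.2 * xl.1) <= 4 * l xl.1)].
  apply: contrapT => nb; apply: nbnd; exists n.+1%:R => // x lam nx lam12.
  by apply: contrapT => h; apply: nb; exists (x, lam).
pose xl n := projT1 (cid (bad n)).
pose x n := (xl n).1; pose lam n := (xl n).2.
have xn n : n.+1%:R <= x n by rewrite /x /xl; case: cid => /= ? [].
have lam12 n : 1 <= lam n <= 2 by rewrite /lam /xl; case: cid => /= ? [].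
have xbad n : ~ (l (x n) / 4 <= l (lam n * x n) <= 4 * l (x n)).
  by rewrite /x /lam /xl; case: cid => /= ? [].
have x0 n : 0 < x n by rewrite (lt_le_trans _ (xn n)).
have xoo : x n @[n --> \oo] --> +oo.
  apply: (@ger_cvgy _ _ _ _ (fun n => n%:R)) => //; last exact: cvgr_idn.
  by apply: nearW => n; rewrite (le_trans _ (xn n)) // ler_nat.
pose y n := lam n * x n.
have xy n : x n <= y n by rewrite ler_peMl ?(andP (lam12 n)).1 // ltW.
have y0 n : 0 < y n by rewrite (lt_le_trans _ (xy n)).
have yoo : y n @[n --> \oo] --> +oo.
  by apply: (ger_cvgy _ xoo); apply: nearW => n; exact: xy.
have near_half (F : nat -> set R) : lebesgue_measure (F n) @[n --> \oo] --> 0%E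
    -> \forall n \near \oo, (lebesgue_measure (F n) < (2^-1)%:E)%E.
  by move/cvge0_lt; apply; rewrite invr_gt0.
near \oo => n.
have hx : (lebesgue_measure (ratio_off (x n)) < (2^-1)%:E)%E.
  by near: n; exact/near_half/cvg_measure_ratio_off.
have hy : (lebesgue_measure (ratio_off (y n)) < (2^-1)%:E)%E.
  by near: n; exact/near_half/cvg_measure_ratio_off.
have [lam1 lam2] := andP (lam12 n).
have lam0 : 0 < lam n by rewrite (lt_le_trans _ lam1).
(* The point [s * x n] is also [(s / lam n) * y n]; [B] collects the [s] for which it is bad
   relative to [y n]. Dilation by [lam n <= 2] keeps the measure of [B] below 1. *)
pose B := [set s | ratio_off (y n) ((lam n)^-1 * s)].
have mB : measurable B.
  rewrite -[B]setTI.
  have mc : measurable_fun setT (fun s => (lam n)^-1 * s).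
    exact: mulrl_measurable.
  by apply: mc => //; exact: measurable_ratio_off.
have hB : (lebesgue_measure B < 1)%E.
  rewrite lebesgue_measure_scale ?invr_gt0 //; last exact: measurable_ratio_off.
  rewrite invrK (@lt_le_trans _ _ ((lam n)%:E * (2^-1)%:E)%E) //.
    by rewrite lte_pmul2l // lte_fin.
  by rewrite -EFinM lee_fin; lra.
(* [[2, 4]] has measure 2, while the two bad sets together have measure below 3/2. At a good [s],
   comparing [l (x n)] and [l (y n)] with [l (s * x n)] loses a factor 2 each time, hence 4 in
   all. *)
have [s s24 sgood] : exists2 s, 2 <= s <= 4 & ~ (ratio_off (x n) `|` B) s.
  apply: contrapT => h.
  have sub : `[2, 4] `<=` ratio_off (x n) `|` B.
    move=> s /=; rewrite in_itv /= => s24; apply: contrapT => hs.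
    by apply: h; exists s.
  have : (lebesgue_measure (`[2%R, 4%R]%classic : set R) <=
          lebesgue_measure (ratio_off (x n)) + lebesgue_measure B)%E.
    apply: le_trans (measureU2 _ _ _) => //; last exact: measurable_ratio_off.
    apply: le_measure => //; first by apply: mem_set.
    by apply: mem_set; apply: measurableU => //; exact: measurable_ratio_off.
  rewrite lebesgue_measure_itv /= lte_fin ltr_nat /=.
  apply/negP; rewrite -ltNge.
  apply: lt_trans (lteD hx hB) _.
  by rewrite -!EFinD lte_fin; lra.
have [s2 s4] := andP s24.
have g1 : 2^-1 <= l (s * x n) / l (x n) <= 2.
  by apply: contrapT => h; apply: sgood; left; split => //; lra.
have g2 : 2^-1 <= l (s * x n) / l (y n) <= 2.
  apply: contrapT => h; apply: sgood; right; split => /=.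
    rewrite ler_pdivlMl // mulr1 ler_pdivrMl //; apply/andP; split; first lra.
    by nra.
  by rewrite /y mulrA [(lam n)^-1 * s]mulrC -(mulrA s) mulVf ?gt_eqF // mulr1.
apply: (xbad n).
have lx := l_gt0 _ (x0 n); have ly := l_gt0 _ (y0 n).
move: g1 g2; rewrite !ler_pdivlMr // !ler_pdivrMr // -/(y n).
move=> /andP[a1 a2] /andP[b1 b2].
by apply/andP; split; lra.
Unshelve. all: by end_near. Qed.

End SlowVariation.

(** * Sublinear expectations and capacities *)

Lemma ler_coord_norm (R : realType) (n : nat) (v : 'rV[R]_n) (i : 'I_n) :
  `|v 0 i| <= `|v|.
Proof. by rewrite [`|v|]mx_normrE; exact: (le_bigmax _ _ (0, i)). Qed.

Lemma C_b_Lip_l (R : realType) (f : R -> R) : C_b_Lip f -> C_l_Lip f.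
Proof.
move=> [C C0 [_ fC]]; exists C => //; exists 0%N => x y.
apply: le_trans (fC x y) _; rewrite ler_wpM2r // ler_peMr ?ltW //.
by rewrite !expr0; lra.
Qed.

Section RandomVariableSpace.
Variables (d : measure_display) (Omega : measurableType d) (R : realType).
Variable H : set (Omega -> R).
Hypothesis hH : random_variable_space H.

Lemma rvs_comp1 (X : Omega -> R) (phi : R -> R) :
  H X -> C_l_Lip phi -> H (fun w => phi (X w)).
Proof.
move=> HX [C C0 [m hphi]].
have -> : (fun w => phi (X w)) =
    (fun w => (fun v : 'rV[R]_1 => phi (v 0 0)) (\row_i (fun=> X) i w)).
  by apply/funext => w; rewrite mxE.
apply: (@rvs_comp _ _ _ _ hH 1 (fun=> X) (fun v : 'rV[R]_1 => phi (v 0 0))) => //.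
exists C => //; exists m => x y.
apply: le_trans (hphi _ _) _.
have h (v : 'rV[R]_1) : `|v 0 0| ^+ m <= `|v| ^+ m.
  by rewrite lerXn2r ?nnegrE ?ler_coord_norm.
have hxy : `|x 0 0 - y 0 0| <= `|x - y|.
  by apply: le_trans (ler_coord_norm (x - y) 0); rewrite !mxE.
apply: ler_pM => //; last by rewrite ler_pM2l // lerD // lerD.
by rewrite mulr_ge0 ?ltW // !addr_ge0.
Qed.

Lemma rvs_cst (c : R) : H (fun=> c).
Proof.
apply: (rvs_comp1 (phi := fun=> c) (rvs_zero hH)).
by exists 1 => //; exists 0%N => x y; rewrite subrr normr0 mulr_ge0 // !expr0; lra.
Qed.

Lemma rvs_mul (X Y : Omega -> R) : H X -> H Y -> H (fun w => X w * Y w).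
Proof.
move=> HX HY; pose Z (i : 'I_2) := if i == 0 then X else Y.
have -> : (fun w => X w * Y w) =
    (fun w => (fun v : 'rV[R]_2 => v 0 0 * v 0 1) (\row_i Z i w)).
  by apply/funext => w; rewrite !mxE.
apply: (@rvs_comp _ _ _ _ hH 2 Z (fun v : 'rV[R]_2 => v 0 0 * v 0 1)).
  by move=> i; rewrite /Z; case: ifP.
exists 1 => //; exists 1%N => x y; rewrite mul1r !expr1.
rewrite (_ : _ - _ = x 0 0 * (x - y) 0 1 + (x - y) 0 0 * y 0 1); last first.
  by rewrite !mxE; ring.
apply: le_trans (ler_normD _ _) _; rewrite !normrM.
have := ler_coord_norm x 0; have := ler_coord_norm y 1.
have := ler_coord_norm (x - y) 0; have := ler_coord_norm (x - y) 1.
move: (normr_ge0 (x 0 0)) (normr_ge0 (y 0 1)).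
move: (normr_ge0 ((x - y) 0 0)) (normr_ge0 ((x - y) 0 1)).
move: `|x 0 0| `|y 0 1| `|(x - y) 0 0| `|(x - y) 0 1| `|x| `|y| `|x - y|.
by move=> a b c e A B D; nra.
Qed.

Lemma rvs_sum (I : eqType) (s : seq I) (X : I -> Omega -> R) :
  (forall i, i \in s -> H (X i)) -> H (fun w => \sum_(i <- s) X i w).
Proof.
elim: s => [_|j s IH hs].
  by under eq_fun do rewrite big_nil; exact: rvs_cst.
under eq_fun do rewrite big_cons.
apply: (rvs_add hH); first by apply: hs; rewrite mem_head.
by apply: IH => i si; apply: hs; rewrite in_cons si orbT.
Qed.

Lemma rvs_prod (I : eqType) (s : seq I) (X : I -> Omega -> R) :
  (forall i, i \in s -> H (X i)) -> H (fun w => \prod_(i <- s) X i w).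
Proof.
elim: s => [_|j s IH hs].
  by under eq_fun do rewrite big_nil; exact: rvs_cst.
under eq_fun do rewrite big_cons.
apply: rvs_mul; first by apply: hs; rewrite mem_head.
by apply: IH => i si; apply: hs; rewrite in_cons si orbT.
Qed.

Variable E : (Omega -> R) -> \bar R.
Hypothesis hE : sublinear_expectation H E.
Local Open Scope ereal_scope.

Lemma sle_ge0 (X : Omega -> R) : H X -> (forall w, (0 <= X w)%R) -> 0 <= E X.
Proof.
move=> HX X0; rewrite -[0]/(0%R%:E) -(sle_cst hE).
by apply: (sle_mono hE) => //; exact: rvs_cst.
Qed.

(** Real upper bounds exclude the value [+oo], so the sum of expectations is never an indeterminate
    form, even if one of them is [-oo]. *)
Lemma sle_add_le (X Y : Omega -> R) (x y : R) : H X -> H Y ->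
  E X <= x%:E -> E Y <= y%:E -> E (fun w => X w + Y w)%R <= (x + y)%:E.
Proof.
move=> HX HY EX EY; apply: (@le_trans _ _ (E X + E Y)); last first.
  by rewrite EFinD; exact: leeD.
apply: (sle_subadd hE) => //.
by apply: ltpinfty_adde_def; rewrite inE; apply: le_lt_trans (ltry _); eassumption.
Qed.

Lemma sle_scale_le (c x : R) (X : Omega -> R) : H X -> (0 <= c)%R ->
  E X <= x%:E -> E (fun w => c * X w)%R <= (c * x)%:E.
Proof.
move=> HX; rewrite le_eqVlt => /predU1P[<- _|c0 EX].
  by under eq_fun do rewrite mul0r; rewrite (sle_cst hE) mul0r.
by rewrite (sle_scale hE) // EFinM lee_pmul2l.
Qed.

Lemma sle_sum_le (I : eqType) (s : seq I) (X : I -> Omega -> R) (x : I -> R) :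
  (forall i, i \in s -> H (X i)) -> (forall i, i \in s -> E (X i) <= (x i)%:E) ->
  E (fun w => \sum_(i <- s) X i w)%R <= (\sum_(i <- s) x i)%:E.
Proof.
elim: s => [_ _|j s IH hs Es].
  by under eq_fun do rewrite big_nil; rewrite big_nil (sle_cst hE).
under eq_fun do rewrite big_cons; rewrite big_cons.
have hs' i : i \in s -> i \in j :: s by rewrite in_cons orbC => ->.
apply: sle_add_le; [exact/hs/mem_head| |exact/Es/mem_head|].
  by apply: rvs_sum => i /hs'; exact: hs.
by apply: IH => i /hs'; [exact: hs | exact: Es].
Qed.

Lemma sle_C_b_Lip_fin (X : Omega -> R) (f : R -> R) :
  H X -> C_b_Lip f -> E (f \o X) \is a fin_num.
Proof.
move=> HX hf; have Hf : H (f \o X) by apply: rvs_comp1 => //; exact: C_b_Lip_l.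
have [C C0 [fC _]] := hf; rewrite fin_numElt.
apply/andP; split; [apply: (@lt_le_trans _ _ (- C)%:E)|apply: (@le_lt_trans _ _ C%:E)].
- exact: ltNyr.
- rewrite -(sle_cst hE (- C)); apply: (sle_mono hE) => //; first exact: rvs_cst.
  by move=> w; have := fC (X w); rewrite ler_norml => /andP[].
- rewrite -(sle_cst hE C); apply: (sle_mono hE) => //; first exact: rvs_cst.
  by move=> w; have := fC (X w); rewrite ler_norml => /andP[].
- exact: ltry.
Qed.

(** Identical distribution transfers only finite expectations; boundedness of [f] makes both sides
    finite. *)
Lemma sle_identically_distributed (X Y : Omega -> R) (f : R -> R) :
  H X -> H Y -> identically_distributed E X Y -> C_b_Lip f ->
  E (f \o X) = E (f \o Y).
Proof.
move=> HX HY XY hf; apply: XY; [exact: C_b_Lip_l| |];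
by apply: sle_C_b_Lip_fin.
Qed.

Notation V := (capacity H E).

Lemma capacity_le (A : set Omega) (xi : Omega -> R) :
  H xi -> (forall w, (0 <= xi w)%R) -> (forall w, A w -> (1 <= xi w)%R) ->
  V A <= E xi.
Proof.
move=> Hxi xi0 xi1; apply: ereal_inf_lbound; exists xi => //; split => // w.
by rewrite indicE; have [/set_mem/xi1|_] := boolP (w \in A).
Qed.

Lemma capacity_ge0 (A : set Omega) : 0 <= V A.
Proof.
apply: le_ereal_inf_tmp => _ [xi [Hxi xi1] <-]; apply: sle_ge0 => // w.
by apply: le_trans (xi1 w); rewrite indicE.
Qed.

Lemma capacity_le1 (A : set Omega) : V A <= 1.
Proof.
rewrite -[1]/(1%R%:E) -(sle_cst hE); apply: capacity_le => //; exact: rvs_cst.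
Qed.

Lemma capacity_fin_num (A : set Omega) : V A \is a fin_num.
Proof.
rewrite ge0_fin_numE ?capacity_ge0 //.
by apply: le_lt_trans (capacity_le1 A) _; exact: ltry.
Qed.

Lemma capacityT : V setT = 1.
Proof.
apply/eqP; rewrite eq_le capacity_le1 /=.
apply: le_ereal_inf_tmp => _ [xi [Hxi xi1] <-].
rewrite -[1]/(1%R%:E) -(sle_cst hE).
apply: (sle_mono hE) => // [|w]; first exact: rvs_cst.
by have := xi1 w; rewrite indicE in_setT.
Qed.

Lemma le_capacity (A B : set Omega) : A `<=` B -> V A <= V B.
Proof.
move=> AB; apply: ereal_inf_le_tmp => _ [xi [Hxi xi1] <-].
exists xi => //; split => // w; apply: le_trans (xi1 w).
by rewrite !indicE ler_nat; have [/set_mem/AB/mem_set->|] := boolP (w \in A).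
Qed.

(** The infimum defining the capacity need not be attained, whence the slack [e]. *)
Lemma capacity_majorant (A : set Omega) (e : R) : (0 < e)%R ->
  exists xi, [/\ H xi, forall w, (0 <= xi w)%R, forall w, A w -> (1 <= xi w)%R &
    E xi <= (fine (V A) + e)%:E].
Proof.
move=> e0; have [_ [xi [Hxi xi1] <-] Exi] :=
  lb_ereal_inf_adherent e0 (capacity_fin_num A).
exists xi; split => //.
- by move=> w; apply: le_trans (xi1 w); rewrite indicE.
- by move=> w Aw; have := xi1 w; rewrite indicE mem_set.
- by rewrite EFinD fineK ?capacity_fin_num // ltW.
Qed.

Lemma capacityU (A B : set Omega) : V (A `|` B) <= V A + V B.
Proof.
apply/lee_addgt0Pr => e e0; have e2 : (0 < e / 2)%R by rewrite divr_gt0.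
have [xi [Hxi xi0 xi1 Exi]] := capacity_majorant A e2.
have [eta [Heta eta0 eta1 Eeta]] := capacity_majorant B e2.
apply: (@le_trans _ _ (E (fun w => xi w + eta w)%R)).
  apply: capacity_le => [|w|w [Aw|Bw]].
  - exact: (rvs_add hH).
  - by rewrite addr_ge0.
  - by rewrite -[1%R]addr0 lerD // xi1.
  - by rewrite -[1%R]add0r lerD // eta1.
apply: le_trans (sle_add_le Hxi Heta Exi Eeta) _.
rewrite -(fineK (capacity_fin_num A)) -(fineK (capacity_fin_num B)).
by rewrite -!EFinD lee_fin /=; lra.
Qed.

End RandomVariableSpace.

(** * Clipping and tail bounds *)

(** From [1 - y <= e^(-y)] one gets [e^y - 1 - y <= y (e^y - 1)]. The right side is at most
    [y^2 e^y] for [y >= 0], and at most [y^2] for [y < 0]. *)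
Lemma expR_le_quadratic (R : realType) (c y : R) : `|y| <= c ->
  expR y <= 1 + y + expR c * y ^+ 2.
Proof.
rewrite ler_norml => /andP[cy yc].
have h1 := expR_ge1Dx y; have h2 := expR_ge1Dx (- y).
have e0 := expR_gt0 y.
have ee : expR y * expR (- y) = 1 by rewrite -expRD subrr expR0.
have h3 : expR y - 1 <= y * expR y by nra.
have ec : expR y <= expR c by rewrite ler_expR.
have c1 : 1 <= expR c by rewrite -expR0 ler_expR; lra.
have [y0|y0] := leP 0 y.
  have : y * (expR y - 1) <= y * (y * expR y) by rewrite ler_wpM2l.
  by nra.
have : - y * (1 - expR y) <= - y * - y by rewrite ler_wpM2l //; lra.
by nra.
Qed.

Section Clip.
Variable R : realType.
Implicit Types (x y c eta : R).

(** Truncation by projection rather than by an indicator: the result is bounded, Lipschitz and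
    non-decreasing, hence an admissible test function both for [H] and for negative dependence. *)
Definition clip eta y : R := Num.max (- eta) (Num.min y eta).

Lemma clip_cases eta y : 0 <= eta ->
  [\/ y <= - eta /\ clip eta y = - eta,
      - eta <= y <= eta /\ clip eta y = y | eta <= y /\ clip eta y = eta].
Proof.
move=> e0; rewrite /clip; have [ye|ye] := leP y eta.
  have [ey|ey] := leP (- eta) y; last by apply: Or31; split => //; exact: ltW.
  by apply: Or32.
by apply: Or33; split; [exact: ltW | rewrite max_r //; lra].
Qed.

Lemma clip_norm_le eta y : 0 <= eta -> `|clip eta y| <= eta.
Proof.
move=> e0; rewrite ler_norml.
by case: (clip_cases y e0) => -[h ->]; apply/andP; split; lra.
Qed.

Lemma clip_id eta y : `|y| <= eta -> clip eta y = y.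
Proof.
rewrite /clip ler_norml => /andP[h1 h2].
by rewrite (min_idPl h2) (max_idPr h1).
Qed.

Lemma clip_norm_ge eta y : 0 <= eta -> eta <= `|y| -> `|clip eta y| = eta.
Proof.
move=> e0; case: (clip_cases y e0) => -[h ->] hy.
- by rewrite normrN ger0_norm.
- by apply/eqP; rewrite eq_le hy ler_norml andbT.
- by rewrite ger0_norm.
Qed.

Lemma clip_mono eta : {homo clip eta : x y / x <= y}.
Proof.
move=> x y xy; rewrite /clip ge_max !le_max lexx /=.
by rewrite le_min !ge_min xy lexx !orbT.
Qed.

Lemma clip_lipschitz eta x y : 0 <= eta ->
  `|clip eta x - clip eta y| <= `|x - y|.
Proof.
move=> e0; wlog xy : x y / x <= y.
  case: (leP x y) => [xy|/ltW xy] h; first exact: h.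
  by rewrite distrC (distrC x); exact: h.
rewrite distrC (distrC x) !ger0_norm ?subr_ge0 ?clip_mono //.
by case: (clip_cases x e0) => -[h1 ->]; case: (clip_cases y e0) => -[h2 ->]; lra.
Qed.

Lemma clip_le_add eta y : 0 <= eta -> clip eta y <= y + Num.max (`|y| - eta) 0.
Proof.
move=> e0; case: (clip_cases y e0) => -[h ->].
- suff : `|y| - eta <= Num.max (`|y| - eta) 0 by rewrite ler0_norm; lra.
  by rewrite le_max lexx.
- by rewrite lerDl le_max lexx orbT.
- by apply: le_trans h _; rewrite lerDl le_max lexx orbT.
Qed.

Lemma C_b_Lip_clip c eta : 0 <= c -> 0 < eta -> C_b_Lip (fun x => clip eta (c * x)).
Proof.
move=> c0 e0; exists (c + eta); first by lra.
split=> [x|x y]; first by apply: le_trans (clip_norm_le _ (ltW e0)) _; lra.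
apply: le_trans (clip_lipschitz _ _ (ltW e0)) _.
rewrite -mulrBr normrM (ger0_norm c0) ler_wpM2r //; lra.
Qed.

Lemma C_b_Lip_norm (f : R -> R) : C_b_Lip f -> C_b_Lip (fun x => `|f x|).
Proof.
move=> [C C0 [fC fL]]; exists C => //; split=> [x|x y].
  by rewrite normr_id.
by apply: le_trans (fL x y); exact: ler_dist_dist.
Qed.

(** The tangent inequality [e^u - e^v <= e^u (u - v)] reduces the Lipschitz bound to that of [f],
    with [e^u <= e^(t C)]. *)
Lemma C_b_Lip_expR (f : R -> R) (t : R) : 0 <= t ->
  C_b_Lip f -> C_b_Lip (fun x => expR (t * f x)).
Proof.
move=> t0 [C C0 [fC fL]]; exists (expR (t * C) * (1 + t * C)).
  by rewrite mulr_gt0 ?expR_gt0 // ltr_wpDr // mulr_ge0 // ltW.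
have eC x : expR (t * f x) <= expR (t * C).
  by rewrite ler_expR ler_wpM2l //; have := fC x; rewrite ler_norml => /andP[].
have e0 := expR_gt0 (t * C).
have tC : 0 <= t * C by rewrite mulr_ge0 // ltW.
split=> [x|x y].
  by rewrite ger0_norm ?expR_ge0 //; apply: le_trans (eC x) _; nra.
wlog fxy : x y / f y <= f x.
  by case: (leP (f y) (f x)) => [h|/ltW h] W; [exact: W|
    rewrite distrC (distrC x); exact: W].
rewrite ger0_norm; last by rewrite subr_ge0 ler_expR ler_wpM2l.
have h1 : f x - f y <= C * `|x - y| by apply: le_trans (fL x y); rewrite ler_norm.
have h2 : expR (t * f x) - expR (t * f y) <= expR (t * f x) * (t * (f x - f y)).
  have := expR_ge1Dx (t * f y - t * f x); rewrite expRD expRN.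
  have := expR_gt0 (t * f x) => ex h.
  have : expR (t * f x) * (1 + (t * f y - t * f x)) <= expR (t * f y).
    by rewrite mulrC -ler_pdivlMr.
  by nra.
apply: le_trans h2 _.
apply: (@le_trans _ _ (expR (t * C) * (t * (C * `|x - y|)))).
  apply: ler_pM; rewrite ?expR_ge0 ?mulr_ge0 ?subr_ge0 //.
  by rewrite ler_wpM2l.
rewrite -mulrA ler_pM2l // mulrA ler_wpM2r //; lra.
Qed.

Lemma C_b_Lip_sqr (f : R -> R) : C_b_Lip f -> C_b_Lip (fun x => f x ^+ 2).
Proof.
move=> [C C0 [fC fL]]; exists (C ^+ 2 + 2 * C ^+ 2).
  by rewrite addr_gt0 ?mulr_gt0 ?exprn_gt0.
split=> [x|x y].
  rewrite normrX; apply: (@le_trans _ _ (C ^+ 2)).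
    by rewrite lerXn2r ?nnegrE ?fC // ltW.
  by rewrite lerDl mulr_ge0 // sqr_ge0.
rewrite subr_sqr normrM.
have h1 : `|f x + f y| <= 2 * C.
  by apply: le_trans (ler_normD _ _) _; have := fC x; have := fC y; lra.
apply: (@le_trans _ _ ((C * `|x - y|) * (2 * C))); first exact: ler_pM.
have : 0 <= C ^+ 2 * `|x - y| by rewrite mulr_ge0 // sqr_ge0.
by nra.
Qed.

End Clip.

Lemma prode_le_expR (R : realType) (I : eqType) (s : seq I) (x : I -> \bar R)
    (z : I -> R) :
  (forall i, i \in s -> 0 <= x i <= (expR (z i))%:E)%E ->
  (0 <= \prod_(i <- s) x i <= (expR (\sum_(i <- s) z i))%:E)%E.
Proof.
elim: s => [_|j s IH hs]; first by rewrite !big_nil expR0 lexx lee_fin ler01.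
have /andP[j1 j2] := hs j (mem_head _ _).
have /andP[s1 s2] : (0 <= \prod_(i <- s) x i <= (expR (\sum_(i <- s) z i))%:E)%E.
  by apply: IH => i si; apply: hs; rewrite in_cons si orbT.
by rewrite !big_cons expRD EFinM mule_ge0 // lee_pmul.
Qed.

(** * Tail bounds for sums: first moments and Chernoff *)

Section TailBounds.
Variables (d : measure_display) (Omega : measurableType d) (R : realType).
Variables (H : set (Omega -> R)) (E : (Omega -> R) -> \bar R).
Hypotheses (hH : random_variable_space H) (hE : sublinear_expectation H E).

(** On the event, either some [|c i * X i|] reaches 1, and the clipped absolute values sum to at
    least 1, or nothing is clipped and they sum to more than [eps]. The factor [1 + eps^-1] covers
    both cases. *)
Lemma capacity_sum_gt_L1 (I : eqType) (s : seq I) (X : I -> Omega -> R)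
    (c b : I -> R) (eps : R) :
  0 < eps -> (forall i, i \in s -> H (X i)) -> (forall i, i \in s -> 0 <= c i) ->
  (forall i, i \in s -> (E (fun w => `|clip 1 (c i * X i w)|%R) <= (b i)%:E)%E) ->
  (capacity H E [set w | (eps < \sum_(i <- s) c i * X i w)%R] <=
   ((1 + eps^-1) * \sum_(i <- s) b i)%:E)%E.
Proof.
move=> e0 hX c0 hb.
have hY i : i \in s -> H (fun w => `|clip 1 (c i * X i w)|).
  move=> si; apply: (rvs_comp1 hH (phi := fun x => `|clip 1 (c i * x)|)) (hX i si) _.
  exact/C_b_Lip_l/C_b_Lip_norm/C_b_Lip_clip/ltr01/c0.
have k0 : 0 <= 1 + eps^-1 by rewrite addr_ge0 // invr_ge0 ltW.
apply: (@le_trans _ _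
    (E (fun w => (1 + eps^-1) * \sum_(i <- s) `|clip 1 (c i * X i w)|))).
  apply: capacity_le.
  - by apply: (rvs_scale hH); apply: (rvs_sum hH).
  - by move=> w; rewrite mulr_ge0 // sumr_ge0.
  move=> w /= hw.
  have [/hasP[j sj hj]|/hasPn hs] := boolP (has (fun i => 1 <= `|c i * X i w|) s).
    have : 1 <= \sum_(i <- s) `|clip 1 (c i * X i w)|.
      rewrite (big_rem j sj) /= clip_norm_ge // lerDl sumr_ge0 //.
    move: (\sum_(i <- s) _) => S S1.
    have : 0 <= eps^-1 * S by rewrite mulr_ge0 ?invr_ge0 ?ltW //; lra.
    by nra.
  have : eps < \sum_(i <- s) `|clip 1 (c i * X i w)|.
    apply: (lt_le_trans hw); rewrite !big_seq; apply: ler_sum => i si.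
    have := hs i si; rewrite -ltNge => /ltW h.
    by rewrite clip_id // ler_norm.
  move: (\sum_(i <- s) _) => S S1.
  have : 1 <= eps^-1 * S by rewrite mulrC ler_pdivlMr // mul1r ltW.
  by nra.
apply: (sle_scale_le hE) => //; first by apply: (rvs_sum hH).
exact: (sle_sum_le hH hE).
Qed.

(** The clipped variable keeps the exponent within [t * eta], so [expR_le_quadratic] applies
    pointwise. Sublinearity then bounds each term, and [1 + x <= e^x] puts the result in a form that
    multiplies well. *)
Lemma sle_expR_clip_le (X : Omega -> R) (c eta t m b : R) :
  H X -> 0 <= c -> 0 < eta -> 0 <= t ->
  (E (fun w => clip eta (c * X w))%R <= m%:E)%E ->
  (E (fun w => clip eta (c * X w) ^+ 2)%R <= (eta ^+ 2 * b)%:E)%E ->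
  (E (fun w => expR (t * clip eta (c * X w)))%R <=
   (expR (t * m + (t * eta) ^+ 2 * expR (t * eta) * b))%:E)%E.
Proof.
move=> HX c0 e0 t0 hm hb.
have hY : H (fun w => clip eta (c * X w)).
  by apply: (rvs_comp1 hH (phi := fun x => clip eta (c * x))) => //;
    exact/C_b_Lip_l/C_b_Lip_clip.
have hY2 : H (fun w => clip eta (c * X w) ^+ 2).
  by apply: (rvs_comp1 hH (phi := fun x => x ^+ 2) hY) => //;
  exists 1 => //; exists 1%N => x y; rewrite subr_sqr normrM mulrC ler_wpM2r //;
  apply: le_trans (ler_normD _ _) _; rewrite !expr1; lra.
have a0 : 0 <= t ^+ 2 * expR (t * eta) by rewrite mulr_ge0 ?expR_ge0 ?sqr_ge0.
apply: (@le_trans _ _ (E (fun w => 1 + (t * clip eta (c * X w) +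
    t ^+ 2 * expR (t * eta) * clip eta (c * X w) ^+ 2)))).
  apply: (sle_mono hE).
  - apply: (rvs_add hH); first exact: (rvs_cst hH).
    by apply: (rvs_add hH); apply: (rvs_scale hH).
  - apply: (rvs_comp1 hH (phi := fun x => expR (t * clip eta (c * x)))) => //.
    exact/C_b_Lip_l/C_b_Lip_expR/C_b_Lip_clip.
  - move=> w; apply: (le_trans (@expR_le_quadratic _ (t * eta) _ _)).
      by rewrite normrM (ger0_norm t0) ler_wpM2l // clip_norm_le // ltW.
    by rewrite exprMn; lra.
apply: (@le_trans _ _ (1 + (t * m + t ^+ 2 * expR (t * eta) * (eta ^+ 2 * b)))%:E).
  apply: (sle_add_le hE).
  - exact: (rvs_cst hH).
  - by apply: (rvs_add hH); apply: (rvs_scale hH).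
  - by rewrite (sle_cst hE).
  - apply: (sle_add_le hE); rewrite ?(sle_scale_le hE) //; exact: (rvs_scale hH).
rewrite lee_fin; apply: le_trans (expR_ge1Dx _) => //.
by rewrite exprMn; lra.
Qed.

(* Chernoff bound for the clipped sum with t = (2/eps) ln(1/r); since
   eta <= eps/8, the factor e^(t eta) <= r^(-1/4) does not destroy the
   gain r from the second moments. *)
Lemma capacity_sum_gt_END (X : nat -> Omega -> R) (K : R) :
  1 <= K -> (forall n, (1 <= n)%N -> H (X n)) ->
  (forall f : nat -> R -> R,
      (forall i, (1 <= i)%N ->
        [/\ C_b_Lip (f i), (forall x, 0 <= f i x) & {homo f i : x y / x <= y}]) ->
      forall n, (1 <= n)%N ->
        (E (fun w => \prod_(1 <= i < n.+1) f i (X i w))%R <=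
        K%:E * \prod_(1 <= i < n.+1) E (f i \o X i))%E) ->
  forall (n : nat) (c m b : nat -> R) (eta eps r : R),
  (1 <= n)%N -> 0 < eta -> eta <= eps / 8 -> 0 < r ->
  (forall i, (1 <= i <= n)%N -> 0 <= c i) ->
  (forall i, (1 <= i <= n)%N ->
    (E (fun w => clip eta (c i * X i w))%R <= (m i)%:E)%E) ->
  (forall i, (1 <= i <= n)%N ->
    (E (fun w => clip eta (c i * X i w) ^+ 2)%R <= (eta ^+ 2 * b i)%:E)%E) ->
  \sum_(1 <= i < n.+1) m i <= eps / 2 -> \sum_(1 <= i < n.+1) b i <= r ->
  (capacity H E [set w | (eps < \sum_(1 <= i < n.+1) c i * X i w)%R] <=
   ((1 + K * expR 1) * r)%:E)%E.
Proof.
move=> K1 hX hEND n c m b eta eps r n1 eta0 etaeps r0 c0 hm hb sm sb.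
have K0 : 0 < K by rewrite (lt_le_trans _ K1).
have Ke0 : 0 < K * expR 1 by rewrite mulr_gt0 ?expR_gt0.
have [r1|r1] := leP 1 r.
  apply: le_trans (capacity_le1 hH hE _) _; rewrite lee_fin.
  have : 0 <= K * expR 1 * r by rewrite mulr_ge0 // ltW.
  by nra.
have eps0 : 0 < eps by lra.
pose L := - ln r; have L0 : 0 < L by rewrite /L oppr_gt0 ln_lt0 // r0.
have rL : expR (- L) = r by rewrite opprK lnK.
pose t := 2 / eps * L.
have t0 : 0 <= t by rewrite mulr_ge0 ?divr_ge0 // ltW.
have teps : t * eps = 2 * L by rewrite /t mulrAC divfK ?gt_eqF.
have teta : t * eta <= L / 4.
  by have := ler_wpM2l t0 etaeps; lra.
have inI i : i \in index_iota 1 n.+1 -> (1 <= i <= n)%N by rewrite mem_index_iota ltnS.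
pose Y i w := clip eta (c i * X i w).
have hY i : i \in index_iota 1 n.+1 -> H (Y i).
  move=> /inI /[dup] /c0 ci /andP[i1 _].
  apply: (rvs_comp1 hH (phi := fun x => clip eta (c i * x)) (hX i i1)).
  exact/C_b_Lip_l/C_b_Lip_clip.
have hY2 i : i \in index_iota 1 n.+1 -> H (fun w => Y i w ^+ 2).
  by move=> si; rewrite (_ : (fun w => _) = (fun w => Y i w * Y i w)) //;
    apply: (rvs_mul hH); exact: hY.
have hYe i : i \in index_iota 1 n.+1 -> H (fun w => expR (t * Y i w)).
  move=> /inI /[dup] /c0 ci /andP[i1 _].
  apply: (rvs_comp1 hH (phi := fun x => expR (t * clip eta (c i * x))) (hX i i1)).
  exact/C_b_Lip_l/C_b_Lip_expR/C_b_Lip_clip.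
have etaV0 : 0 <= (eta ^+ 2)^-1 by rewrite invr_ge0 sqr_ge0.
(* If some [|c i * X i|] reaches [eta], its clipped square alone makes the first term at least 1.
   Otherwise nothing is clipped, and on the event the exponential term is at least 1. *)
apply: (@le_trans _ _
    (E (fun w => (eta ^+ 2)^-1 * \sum_(1 <= i < n.+1) Y i w ^+ 2 +
        expR (- (t * eps)) * \prod_(1 <= i < n.+1) expR (t * Y i w)))).
  apply: capacity_le.
  - by apply: (rvs_add hH); apply: (rvs_scale hH);
      [apply: (rvs_sum hH)|apply: (rvs_prod hH)].
  - move=> w; rewrite addr_ge0 ?mulr_ge0 ?expR_ge0 //.
      by apply: sumr_ge0 => i _; exact: sqr_ge0.
    by apply: prodr_ge0 => i _; exact: expR_ge0.
  move=> w /= hw.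
  have p0 : 0 <= expR (- (t * eps)) * \prod_(1 <= i < n.+1) expR (t * Y i w).
    by rewrite mulr_ge0 ?expR_ge0 //; apply: prodr_ge0 => i _; exact: expR_ge0.
  have s0 : 0 <= (eta ^+ 2)^-1 * \sum_(1 <= i < n.+1) Y i w ^+ 2.
    by rewrite mulr_ge0 //; apply: sumr_ge0 => i _; exact: sqr_ge0.
  have [/hasP[j sj hj]|/hasPn hs] :=
      boolP (has (fun i => eta <= `|c i * X i w|) (index_iota 1 n.+1)).
    apply: ler_wpDr; first exact: p0.
    rewrite ler_pdivlMl ?exprn_gt0 // mulr1.
    rewrite (big_rem j sj) /=.
    have -> : Y j w ^+ 2 = eta ^+ 2.
      by rewrite -real_normK ?num_real // /Y clip_norm_ge // ltW.
    by rewrite lerDl sumr_ge0 // => i _; exact: sqr_ge0.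
  apply: ler_wpDl; first exact: s0.
  rewrite -expR_sum -expRD -expR0 ler_expR -mulr_sumr.
  rewrite addrC subr_ge0 ler_wpM2l // ltW // (lt_le_trans hw) //.
  rewrite le_eqVlt; apply/orP; left; apply/eqP.
  rewrite !big_seq; apply: eq_bigr => i si.
  by rewrite /Y clip_id // ltW // ltNge; exact: hs.
rewrite mulrDl mul1r.
apply: (sle_add_le hE).
- by apply: (rvs_scale hH); apply: (rvs_sum hH).
- by apply: (rvs_scale hH); apply: (rvs_prod hH).
- apply: (@le_trans _ _ ((eta ^+ 2)^-1 * \sum_(1 <= i < n.+1) (eta ^+ 2 * b i))%:E).
    apply: (sle_scale_le hE) => //; first by apply: (rvs_sum hH).
    by apply: (sle_sum_le hH hE) => // i /inI; exact: hb.
  by rewrite lee_fin -mulr_sumr mulKf // expf_neq0 // gt_eqF.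
- pose q := (t * eta) ^+ 2 * expR (t * eta).
  have q0 : 0 <= q by rewrite mulr_ge0 ?expR_ge0 ?sqr_ge0.
  apply: (@le_trans _ _ (expR (- (t * eps)) *
      (K * expR (\sum_(1 <= i < n.+1) (t * m i + q * b i))))%:E).
    apply: (sle_scale_le hE); [by apply: (rvs_prod hH)|exact: expR_ge0|].
    (* Negative dependence asks for monotonicity of [f i] at every [i >= 1], whereas [c i >= 0] is
       known only for [i <= n]; the absolute value bridges the gap. *)
    pose f i x := expR (t * clip eta (`|c i| * x)).
    have Ef w : \prod_(1 <= i < n.+1) expR (t * Y i w) =
        \prod_(1 <= i < n.+1) f i (X i w).
      rewrite !big_seq; apply: eq_bigr => i /inI /c0 ci.
      by rewrite /f /Y ger0_norm.
    under eq_fun do rewrite Ef.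
    apply: le_trans (hEND f _ n n1) _.
      move=> i i1; split=> [|x|x y xy]; rewrite /f.
      - exact/C_b_Lip_expR/C_b_Lip_clip.
      - exact: expR_ge0.
      - by rewrite ler_expR ler_wpM2l // clip_mono // ler_wpM2l.
    rewrite EFinM lee_pmul2l //.
    suff /andP[] : (0 <= \prod_(1 <= i < n.+1) E (f i \o X i) <=
      (expR (\sum_(1 <= i < n.+1) (t * m i + q * b i)))%:E)%E by [].
    apply: prode_le_expR => i si.
    have /andP[i1 _] := inI i si; have ci := c0 i (inI i si).
    have -> : f i \o X i = (fun w => expR (t * Y i w)).
      by apply/funext => w; rewrite /f /Y /= ger0_norm.
    rewrite (sle_ge0 hH hE) /=; [|exact: hYe|by move=> w; exact: expR_ge0].
    apply: sle_expR_clip_le => //; [exact: hX|exact/hm/inI|exact/hb/inI].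
  rewrite lee_fin big_split /= -!mulr_sumr mulrCA -expRD -mulrA ler_pM2l //.
  (* Since [t * eps = 2 L], with at most [L] coming from the means and at most 1 from the second
     moments, the exponent is at most [1 - L]; this is the factor [expR 1 * r]. *)
  rewrite -rL -expRD ler_expR teps.
  have h1 : t * \sum_(1 <= i < n.+1) m i <= L.
    by have := ler_wpM2l t0 sm; lra.
  (* Here [(t eta)^2 <= e^(L/2)], [e^(t eta) <= e^(L/4)] and [r = e^(-L)], so the product is at most
     [e^(-L/4)]. *)
  have h2 : q * \sum_(1 <= i < n.+1) b i <= 1.
    apply: (@le_trans _ _ (q * r)); first by rewrite ler_wpM2l.
    rewrite /q -rL -mulrA -expRD.
    have u0 : 0 <= t * eta by rewrite mulr_ge0 // ltW.
    have hu : t * eta <= expR (L / 4).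
      by have := expR_ge1Dx (L / 4); lra.
    apply: (@le_trans _ _ (expR (L / 4) ^+ 2 * expR (L / 4 - L))).
      by rewrite ler_pM ?sqr_ge0 ?expR_ge0 // ?lerXn2r ?nnegrE ?expR_ge0 //
        ler_expR lerD2r.
    rewrite expr2 -!expRD -[leRHS]expR0 ler_expR; lra.
  lra.
Qed.

End TailBounds.

(** * Dyadic sums *)

Section DyadicSlowVariation.
Variables (R : realType) (l : R -> R).
Hypothesis hl : slowly_varying l.

(** The first bound is [slowly_varying_ratio_bound] at [2^k]; the others hold because
    [l (2^(k+1)) / l (2^k)] tends to 1. The last one later turns decay by [kappa] into contraction
    of the weighted majorants by [kappa + 1/2 < 1]. *)
Lemma slowly_varying_dyadic (kappa : R) : 0 < kappa < 2^-1 ->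
  exists k0 : nat, forall k, (k0 <= k)%N ->
    [/\ forall x, 2 ^+ k <= x <= 2 ^+ k.+1 ->
          l (2 ^+ k) / 4 <= l x <= 4 * l (2 ^+ k),
        3 / 2 * (2 ^+ k * l (2 ^+ k)) <= 2 ^+ k.+1 * l (2 ^+ k.+1),
        2 ^+ k.+1 * l (2 ^+ k.+1) <= 3 * (2 ^+ k * l (2 ^+ k)) &
        kappa * (2 ^+ k.+1 * l (2 ^+ k.+1)) <=
          (kappa + 2^-1) * (2 ^+ k * l (2 ^+ k))].
Proof.
move=> /andP[kap0 kap2]; have [l_gt0 _ lim_l] := hl.
have [x0 x00 hx0] := slowly_varying_ratio_bound hl.
(* For the ratio [q] of consecutive dyadic values, the first entry puts [2 q] between 3/2 and 5/2,
   and the second gives [2 kappa q <= kappa + 1/2]. *)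
pose del := Num.min 4^-1 ((2^-1 - kappa) / 2).
have del0 : 0 < del by rewrite lt_min; apply/andP; split; lra.
have [M [_ hM]] : \forall x \near +oo, `|1 - l (2 * x) / l x| < del.
  by move: (lim_l 2 (ltr0Sn R 1)); move/cvgr_dist_lt; apply.
have [k0 hk0] : exists k0 : nat, Num.max x0 M < k0%:R.
  have := truncn_itv (_ : 0 <= Num.max x0 M); rewrite le_max ltW //=.
  by move=> /(_ isT)/andP[_ h]; eexists; exact: h.
exists k0 => k kk0.
have big : Num.max x0 M < 2 ^+ k.
  apply: lt_trans hk0 _; rewrite -natrX ltr_nat.
  by apply: leq_ltn_trans kk0 _; exact: ltn_expl.
move: big; rewrite gt_max => /andP[xk Mk].
have p0 : 0 < 2 ^+ k :> R by rewrite exprn_gt0.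
have lk := l_gt0 _ p0.
have := hM _ Mk; rewrite -exprS lt_min => /andP[]; rewrite !ltr_norml.
set q := l _ / l _ => /andP[a1 a2] /andP[b1 b2].
have El : l (2 ^+ k.+1) = q * l (2 ^+ k) by rewrite /q divfK // gt_eqF.
split.
- move=> x /andP[h1 h2]; have -> : x = (x / 2 ^+ k) * 2 ^+ k by rewrite divfK // gt_eqF.
  apply: hx0; first exact: ltW.
  by rewrite ler_pdivlMr // mul1r h1 ler_pdivrMr // -exprS.
- rewrite El exprS -subr_ge0.
  rewrite (_ : _ - _ = (2 * q - 3 / 2) * (2 ^+ k * l (2 ^+ k))); last by ring.
  by rewrite !mulr_ge0 ?ltW //; lra.
- rewrite El exprS -subr_ge0.
  rewrite (_ : _ - _ = (3 - 2 * q) * (2 ^+ k * l (2 ^+ k))); last by ring.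
  by rewrite !mulr_ge0 ?ltW //; lra.
- rewrite El exprS -subr_ge0.
  rewrite (_ : _ - _ = (kappa + 2^-1 - kappa * 2 * q) * (2 ^+ k * l (2 ^+ k)));
    last by ring.
  by rewrite !mulr_ge0 ?ltW //; nra.
Qed.

End DyadicSlowVariation.

Lemma exists_dyadic (R : realType) (x : R) : 1 <= x ->
  exists j : nat, 2 ^+ j <= x < 2 ^+ j.+1.
Proof.
move=> x1; have /andP[m1 m2] := truncn_itv (le_trans ler01 x1).
have m0 : (0 < Num.truncn x)%N by rewrite truncn_gt0.
have /andP[j1 j2] := trunc_log_bounds (isT : 1 < 2)%N m0.
exists (trunc_log 2 (Num.truncn x)); rewrite -!natrX.
by rewrite (le_trans _ m1) ?ler_nat //= (lt_le_trans m2) // ler_nat.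
Qed.


(** A lower Riemann sum: on [[b k, b k.+1[] the non-increasing [g] is at least [g (b k.+1)], and
    these intervals are disjoint in the half-line. *)
Lemma sum_step_le_integral (R : realType) (g : R -> R) (b : nat -> R) (k0 N : nat) :
  {homo g : x y /~ x <= y} -> (forall x, 0 <= g x) ->
  (forall k, (k0 <= k)%N -> b k <= b k.+1) -> 0 <= b k0 -> (k0 <= N)%N ->
  ((\sum_(k0 <= k < N) (b k.+1 - b k) * g (b k.+1))%:E <=
   \int[lebesgue_measure]_(t in `[0%R, +oo[) (g t)%:E)%E.
Proof.
move=> g_ni g0 b_nd b0 kN.
have mg (D : set R) : measurable D -> measurable_fun D (fun t => (g t)%:E).
  move=> mD; apply/measurable_EFinP; apply: nonincreasing_measurable => //.
  by move=> x y xy; exact: g_ni.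
have b_mono k j : (k0 <= k)%N -> (k <= j)%N -> b k <= b j.
  move=> k0k; elim: j => [|j IH]; first by rewrite leqn0 => /eqP ->.
  rewrite leq_eqVlt => /predU1P[->//|]; rewrite ltnS => kj.
  by apply: le_trans (IH kj) _; apply: b_nd; exact: leq_trans kj.
apply: (@le_trans _ _
    (\int[lebesgue_measure]_(t in `[b k0, b N[) (g t)%:E)%E); last first.
  apply: ge0_subset_integral => //; first exact: mg.
    by move=> t _; rewrite lee_fin.
  move=> t /=; rewrite !in_itv /= => /andP[h _]; rewrite andbT.
  exact: le_trans h.
elim: N kN => [|N IH].
  rewrite leqn0 => /eqP ->; rewrite big_geq // integral_ge0 // => t _.
  by rewrite lee_fin.
rewrite leq_eqVlt => /predU1P[<-|].
  by rewrite big_geq // integral_ge0 // => t _; rewrite lee_fin.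
rewrite ltnS => kN; rewrite big_nat_recr //= EFinD.
have -> : `[b k0, b N.+1[%classic = `[b k0, b N[%classic `|` `[b N, b N.+1[%classic.
  by rewrite -itv_bndbnd_setU // bnd_simp; [exact: b_mono | exact: b_nd].
rewrite ge0_integral_setU //=.
- apply: leeD; first exact: IH.
  apply: (@le_trans _ _
    (\int[lebesgue_measure]_(t in `[b N, b N.+1[) (cst (g (b N.+1))%:E t))%E).
    rewrite integral_cst //= lebesgue_measure_itv /= lte_fin.
    case: ifPn => [h|]; first by rewrite -EFinD -EFinM mulrC.
    rewrite -leNgt => h; rewrite mule0 lee_fin.
    by rewrite (_ : b N.+1 - b N = 0) ?mul0r //; apply/eqP;
      rewrite subr_eq0 eq_le h b_nd.
  apply: ge0_le_integral => //.
  - by move=> t _; rewrite lee_fin.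
  - exact: mg.
  - move=> t /=; rewrite in_itv /= => /andP[_ h].
    by rewrite lee_fin g_ni // ltW.
- by apply: mg; apply: measurableU.
- by move=> t _; rewrite lee_fin.
- apply/disj_setPS => t [/=]; rewrite !in_itv /= => /andP[_ h1] /andP[h2 _].
  by rewrite ltNge h2 in h1.
Qed.

(** The block from [2^k] to [2^(k+1)] has [2^k] terms, each at most [D k]; the bounds [M] serve for
    the finitely many terms before [2^k1]. *)
Lemma nneseries_dyadic_lty (R : realType) (u : nat -> \bar R) (M D : nat -> R)
    (k1 : nat) (B : R) :
  (forall n, (1 <= n)%N -> (0 <= u n <= (M n)%:E)%E) ->
  (forall k n, (k1 <= k)%N -> (2 ^ k <= n < 2 ^ k.+1)%N -> (u n <= (D k)%:E)%E) ->
  (forall N, \sum_(k1 <= k < N) 2 ^+ k * D k <= B) ->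
  (\sum_(1 <= n <oo) u n < +oo)%E.
Proof.
move=> hM hD hB.
have u0 n : (1 <= n)%N -> (0 <= u n)%E by move=> /hM /andP[].
have p1 k : (1 <= 2 ^ k)%N by rewrite expn_gt0.
have block N : (k1 <= N)%N ->
    (\sum_(2 ^ k1 <= n < 2 ^ N) u n <= (\sum_(k1 <= k < N) 2 ^+ k * D k)%:E)%E.
  elim: N => [|N IH]; first by rewrite leqn0 => /eqP ->; rewrite !big_geq.
  rewrite leq_eqVlt => /predU1P[<-|]; first by rewrite !big_geq.
  rewrite ltnS => kN; rewrite big_nat_recr //= EFinD.
  rewrite (@big_cat_nat _ _ _ (2 ^ N)) ?leq_exp2l //=.
  apply: leeD; first exact: IH.
  apply: (@le_trans _ _ (\sum_(2 ^ N <= n < 2 ^ N.+1) (D N)%:E)%E).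
    rewrite !big_seq; apply: lee_sum => n; rewrite mem_index_iota.
    exact: hD.
  rewrite sumEFin lee_fin big_const_nat iter_addr_0.
  by rewrite expnS mul2n -addnn addnK -natrX mulr_natl.
apply: (@le_lt_trans _ _ ((\sum_(1 <= n < 2 ^ k1) M n) + B)%:E); last exact: ltry.
apply: lime_le.
  by apply: is_cvg_nneseries => n n1 _; exact: u0.
apply: nearW => m.
pose N := maxn m k1.
have mN : (m <= 2 ^ N)%N.
  by apply: leq_trans (leq_maxl m k1) _; exact/ltnW/ltn_expl.
have kN : (k1 <= N)%N by exact: leq_maxr.
apply: (@le_trans _ _ (\sum_(1 <= n < 2 ^ N) u n)%E).
  have [m1|m1] := leqP 1 m.
    rewrite (@big_cat_nat _ _ _ m 1 (2 ^ N)) //= leeDl //.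
    rewrite big_seq sume_ge0 // => n; rewrite mem_index_iota => /andP[h _].
    exact/u0/(leq_trans m1).
  rewrite big_geq; last by rewrite ltnW.
  by rewrite big_seq sume_ge0 // => n; rewrite mem_index_iota => /andP[h _]; exact: u0.
rewrite (@big_cat_nat _ _ _ (2 ^ k1)) ?leq_exp2l //= EFinD; apply: leeD.
  rewrite -sumEFin !big_seq; apply: lee_sum => n; rewrite mem_index_iota => /andP[h _].
  by have /andP[] := hM n h.
by apply: le_trans (block _ kN) _; rewrite lee_fin.
Qed.

(** Summing the recursion telescopes; keeping the last term [Z N'] on the left in [key] is what
    makes the induction close. *)
Lemma sum_le_of_contraction (R : realType) (Z D : nat -> R) (theta B : R) (k1 : nat) :
  theta < 1 -> (forall k, 0 <= Z k) ->
  (forall k, (k1 <= k)%N -> Z k.+1 <= theta * Z k + D k) ->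
  (forall N, \sum_(k1 <= k < N) D k <= B) ->
  forall N, \sum_(k1 <= k < N) Z k <= (Z k1 + B) / (1 - theta).
Proof.
move=> th Z0 hZ hD N.
have th0 : 0 < 1 - theta by lra.
have key N' : (k1 <= N')%N -> (1 - theta) * (\sum_(k1 <= k < N') Z k) + Z N' <=
    Z k1 + \sum_(k1 <= k < N') D k.
  elim: N' => [|n IH].
    by rewrite leqn0 => /eqP ->; rewrite !big_geq // mulr0 add0r addr0.
  rewrite leq_eqVlt => /predU1P[<-|]; first by rewrite !big_geq // mulr0 add0r addr0.
  rewrite ltnS => kn; rewrite !big_nat_recr //=.
  by have := IH kn; have := hZ n kn; nra.
rewrite ler_pdivlMr // mulrC.
have [kN|kN] := leqP k1 N.
  by have := key N kN; have := Z0 N; have := hD N; lra.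
have B0 : 0 <= B by have := hD k1; rewrite big_geq.
rewrite big_geq ?mulr0; last exact: ltnW.
by rewrite addr_ge0.
Qed.

(** * Dyadic majorants controlled by the Choquet integral *)

Section TailMajorants.
Variables (d : measure_display) (Omega : measurableType d) (R : realType).
Variables (H : set (Omega -> R)) (E : (Omega -> R) -> \bar R).
Hypotheses (hH : random_variable_space H) (hE : sublinear_expectation H E).
Notation V := (capacity H E).

(** For [Y >= 0] the integral over negative levels vanishes, the whole space having capacity 1. The
    other one dominates every lower Riemann sum, with a bound [B] independent of the grid. *)
Lemma choquet_step_sum (Y : Omega -> R) : (forall w, 0 <= Y w) ->
  (choquet H E Y < +oo)%E ->
  exists B : R, forall (b : nat -> R) (k0 N : nat),
    (forall k, (k0 <= k)%N -> b k <= b k.+1) -> 0 <= b k0 -> (k0 <= N)%N ->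
    \sum_(k0 <= k < N)
      (b k.+1 - b k) * fine (V [set w | b k.+1 <= Y w]) <= B.
Proof.
move=> Y0; pose g t := fine (V [set w | t <= Y w]).
have gE t : V [set w | t <= Y w] = (g t)%:E.
  by rewrite /g fineK // (capacity_fin_num hH hE).
have g0 t : 0 <= g t by rewrite /g fine_ge0 // (capacity_ge0 hH hE).
have g_ni : {homo g : x y /~ x <= y}.
  move=> s t st; rewrite -lee_fin -!gE; apply: le_capacity => w /=.
  exact: le_trans.
rewrite /choquet.
have -> : (\int[lebesgue_measure]_(t in `]-oo, 0%R])
    (V [set w | (t <= Y w)%R] - 1))%E = 0%E.
  rewrite -[RHS](integral0 lebesgue_measure (`]-oo, 0%R]%classic : set R)).
  apply: eq_integral => t; rewrite inE /= in_itv /= => t0.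
  have -> : [set w | t <= Y w] = setT.
    by apply/seteqP; split => // w _ /=; exact: le_trans (Y0 w).
  by rewrite (capacityT hH hE) subee.
under eq_integral do rewrite gE.
rewrite adde0 => I_fin.
exists (fine (\int[lebesgue_measure]_(t in `[0%R, +oo[) (g t)%:E)%E).
move=> b k0 N b_nd b0 kN; rewrite -lee_fin fineK; last first.
  by rewrite ge0_fin_numE // integral_ge0 // => t _; rewrite lee_fin.
exact: sum_step_le_integral.
Qed.

(** Below [2^k] no truncation occurs and doubling the scale costs exactly [2^(-rho)]; from [2^k] on
    the indicator alone dominates. *)
Lemma truncated_powR_layer (rho u : R) (k : nat) : 0 < rho -> 0 <= u ->
  Num.min ((u / 2 ^+ k.+1) `^ rho) 1 <=
  2^-1 `^ rho * Num.min ((u / 2 ^+ k) `^ rho) 1 + (2 ^+ k <= u)%R%:R.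
Proof.
move=> rho0 u0; have p0 : 0 < 2 ^+ k :> R by rewrite exprn_gt0.
have kap0 : 0 <= 2^-1 `^ rho :> R by exact: powR_ge0.
have [ku|uk] := leP (2 ^+ k) u.
  rewrite ge_min; apply/orP; right; rewrite lerDr mulr_ge0 //.
  by rewrite le_min powR_ge0 ler01.
have h : (u / 2 ^+ k) `^ rho <= 1.
  have E1 : 1 `^ rho = 1 :> R by rewrite powR1.
  rewrite -[leRHS]E1; apply: ge0_ler_powR; first exact: ltW.
  - by rewrite nnegrE divr_ge0 // ltW.
  - by rewrite nnegrE.
  - by rewrite ler_pdivrMr // mul1r ltW.
rewrite (min_idPl h) addr0 ge_min; apply/orP; left.
rewrite -powRM ?invr_ge0 ?divr_ge0 // ?(ltW p0) //.
by rewrite exprS invfM mulrCA.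
Qed.

(* W (k+1) = 2^-rho W k + V(2^k <= U) + (summable error), and the weights
   2^k l(2^k) grow by a factor close to 2 < 2^rho. *)
Lemma truncated_powR_majorants (U : Omega -> R) (l : R -> R) (rho : R) :
  1 < rho -> slowly_varying l -> (forall w, 0 <= U w) ->
  (choquet H E (fun w => U w * l (U w))%R < +oo)%E ->
  exists (F : nat -> Omega -> R) (W : nat -> R) (k1 : nat) (B : R),
  [/\ forall k, [/\ H (F k), 0 < W k & (E (F k) <= (W k)%:E)%E],
      forall k w, Num.min ((U w / 2 ^+ k) `^ rho) 1 <= F k w,
      forall k x, (k1 <= k)%N -> 2 ^+ k <= x <= 2 ^+ k.+1 -> l x <= 4 * l (2 ^+ k) &
      forall N, \sum_(k1 <= k < N) 2 ^+ k * l (2 ^+ k) * W k <= B].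
Proof.
move=> rho1 hl U0 hC; have [l_gt0 _ _] := hl.
have rho0 : 0 < rho by rewrite (lt_trans _ rho1).
pose kappa : R := 2^-1 `^ rho.
have kap0 : 0 < kappa by rewrite powR_gt0.
have kap2 : kappa < 2^-1.
  rewrite /kappa -[ltRHS]powRr1 // /powR !gt_eqF //= ltr_expR.
  by rewrite ltr_nM2r // lnV ?posrE // oppr_lt0 ln_gt0 // ltr1n.
have [k0 hk0] := slowly_varying_dyadic hl (introT andP (conj kap0 kap2)).
pose A k : R := 2 ^+ k * l (2 ^+ k).
have A0 k : 0 < A k by rewrite mulr_gt0 ?exprn_gt0 ?l_gt0 ?exprn_gt0.
have A_mono j k : (k0 <= k)%N -> (k <= j)%N -> A k <= A j.
  move=> k0k; elim: j => [|j IH]; first by rewrite leqn0 => /eqP ->.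
  rewrite leq_eqVlt => /predU1P[->//|]; rewrite ltnS => kj.
  apply: le_trans (IH kj) _.
  have [_ h _ _] := hk0 j (leq_trans k0k kj).
  by have := A0 j; rewrite /A in h *; lra.
pose Y w := U w * l (U w).
have Y0 w : 0 <= Y w.
  rewrite /Y; have := U0 w; rewrite le_eqVlt => /predU1P[<-|Uw].
    by rewrite mul0r.
  by rewrite mulr_ge0 // ltW // l_gt0.
(* The map [x * l x] need not be monotone, so [U w] is located in its dyadic block [j >= k]: there
   [l] is at least [l (2^j) / 4], and [A] is non-decreasing from [k0] on. *)
have UY k w : (k0 <= k)%N -> 2 ^+ k <= U w -> A k / 4 <= Y w.
  move=> k0k kU.
  have [j /andP[j1 j2]] : exists j : nat, 2 ^+ j <= U w < 2 ^+ j.+1.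
    by apply: exists_dyadic; rewrite (le_trans _ kU) // exprn_ege1 // ler1n.
  have kj : (k <= j)%N.
    rewrite -ltnS -(@ltr_eXn2l R 2) ?ltr1n //; exact: le_lt_trans j2.
  have k0j := leq_trans k0k kj.
  have [hl1 _ _ _] := hk0 j k0j.
  have /andP[h1 _] := hl1 (U w) (introT andP (conj j1 (ltW j2))).
  apply: (@le_trans _ _ (A j / 4)).
    by rewrite ler_pM2r // A_mono.
  rewrite /A /Y -mulrA; apply: ler_pM => //.
  by rewrite divr_ge0 // ltW // l_gt0 // exprn_gt0.
pose nu k := fine (V [set w | 2 ^+ k <= U w]).
have nu0 k : 0 <= nu k by rewrite fine_ge0 // (capacity_ge0 hH hE).
have [B hB] := choquet_step_sum Y0 hC.
(* The slack is chosen so that [A k * e k = 2^(-k)] is summable. *)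
pose e k := 2^-1 ^+ k / A k.
have e0 k : 0 < e k by rewrite divr_gt0 // exprn_gt0.
have /choice[xi hxi] : forall k, exists xi, [/\ H xi, forall w, 0 <= xi w,
    forall w, 2 ^+ k <= U w -> 1 <= xi w & (E xi <= (nu k + e k)%:E)%E].
  by move=> k; exact: (capacity_majorant hH hE).
pose F := fix F (k : nat) : Omega -> R :=
  if k is k'.+1 then fun w => kappa * F k' w + xi k' w else fun=> 1.
pose W := fix W (k : nat) : R :=
  if k is k'.+1 then kappa * W k' + (nu k' + e k') else 1.
have W0 k : 0 < W k.
  elim: k => [|k IH] //=; rewrite addr_gt0 ?mulr_gt0 //.
  by rewrite ltr_wpDl.
have HF k : H (F k).
  elim: k => [|k IH] /=; first exact: (rvs_cst hH).
  by apply: (rvs_add hH); [exact: (rvs_scale hH)|have [] := hxi k].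
(* The inhomogeneous terms [3 (A k nu k + 2^(-k))] sum to at most [3 * 12 B + 3 * 2]. Starting at
   [k0.+1] leaves the step from [k0] for the Choquet comparison. *)
exists F, W, k0.+1, ((A k0.+1 * W k0.+1 + (36 * B + 6)) / (1 - (kappa + 2^-1))).
split.
- move=> k; split => //; elim: k => [|k IH] /=; first by rewrite (sle_cst hE).
  have [xi1 _ _ xi4] := hxi k.
  apply: (sle_add_le hE) => //; first exact: (rvs_scale hH).
  by apply: (sle_scale_le hE) => //; exact: ltW.
- elim=> [|k IH] w /=; first by rewrite ge_min lexx orbT.
  apply: le_trans (truncated_powR_layer _ rho0 (U0 w)) _.
  apply: lerD; first by rewrite ler_wpM2l // ltW.
  have [_ xi0 xi1 _] := hxi k.
  by have [/xi1|_] := boolP (2 ^+ k <= U w).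
- move=> k x k1k hx; have [h _ _ _] := hk0 k (ltnW k1k).
  by have /andP[] := h x hx.
have kap1 : kappa + 2^-1 < 1 by lra.
move=> N; apply: (sum_le_of_contraction (Z := fun k => A k * W k)
  (D := fun k => 3 * (A k * nu k) + 3 * 2^-1 ^+ k) kap1).
- by move=> k; apply: mulr_ge0; exact: ltW.
- move=> k /ltnW k0k /=; have [_ _ h3 h4] := hk0 k k0k.
  have -> : A k.+1 * (kappa * W k + (nu k + e k)) =
    kappa * A k.+1 * W k + A k.+1 * (nu k + e k) by ring.
  apply: lerD; first by rewrite mulrA ler_wpM2r // ltW.
  have -> : 3 * (A k * nu k) + 3 * 2^-1 ^+ k = 3 * A k * (nu k + e k).
    by rewrite /e; field; rewrite gt_eqF.
  by rewrite ler_wpM2r // addr_ge0 // ltW.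
move=> M; rewrite big_split /= -!mulr_sumr.
have geo : \sum_(k0.+1 <= k < M) 2^-1 ^+ k <= 2 :> R.
  have gen j : \sum_(0 <= k < j) 2^-1 ^+ k = 2 - 2 * 2^-1 ^+ j :> R.
    elim: j => [|j IH]; first by rewrite big_geq // expr0; lra.
    by rewrite big_nat_recr //= IH exprS; lra.
  have [kM|kM] := leqP k0.+1 M; last by rewrite big_geq // ltnW.
  have := gen M; rewrite (@big_cat_nat _ _ _ k0.+1) //= => hM.
  have : 0 <= \sum_(0 <= k < k0.+1) 2^-1 ^+ k :> R.
    by apply: sumr_ge0 => k _; rewrite exprn_ge0.
  have : 0 <= 2^-1 ^+ M :> R by rewrite exprn_ge0.
  by lra.
suff : \sum_(k0.+1 <= k < M) A k * nu k <= 12 * B by lra.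
have b_nd k : (k0 <= k)%N -> A k / 4 <= A k.+1 / 4.
  by move=> k0k; rewrite ler_pM2r // A_mono.
have b0 : 0 <= A k0 / 4 by rewrite divr_ge0 // ltW.
have [k0M|k0M] := ltnP k0 M; last first.
  rewrite big_geq; last exact: leqW.
  have := hB (fun k => A k / 4) k0 k0 b_nd b0 (leqnn k0).
  by rewrite big_geq // => B0; rewrite mulr_ge0.
case: M geo k0M => // M _; rewrite ltnS => k0M.
rewrite big_add1 /=.
(* Growth of [A] by at least 3/2 gives [A k.+1 <= 3 (A k.+1 - A k)]; the grid [A k / 4] contributes
   the remaining factor 4 of the constant 12. *)
apply: (@le_trans _ _ (12 * \sum_(k0 <= k < M)
    (A k.+1 / 4 - A k / 4) * fine (V [set w | A k.+1 / 4 <= Y w]))); last first.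
  by rewrite ler_pM2l //; exact: (hB (fun k => A k / 4)).
rewrite mulr_sumr !big_seq; apply: ler_sum => k; rewrite mem_index_iota => /andP[k0k _].
have [_ h2 _ _] := hk0 k k0k.
have h : nu k.+1 <= fine (V [set w | A k.+1 / 4 <= Y w]).
  rewrite /nu fine_le ?(capacity_fin_num hH hE) //.
  by apply: le_capacity => w /=; apply: UY; exact: leqW.
have A1 := A0 k.+1.
rewrite mulrA; apply: ler_pM => //; first exact: ltW.
by rewrite /A in h2 *; lra.
Qed.

End TailMajorants.

(** * Weighted sums *)

Section PowerBounds.
Variable R : realType.
Implicit Types (x a u eta p q s t : R).

(** With [r = t / s] in [[0, 1]] and [p <= 2], [r^p >= r^2], so the increment is at most
    [s^p (1 - r^2) = (1 + r) s^(p-1) (s - t)]; moreover [s^(p-1) <= 1 + s]. *)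
Lemma powR_increment_le p s t : 1 <= p <= 2 -> 0 <= t -> t <= s ->
  s `^ p - t `^ p <= 2 * (1 + s) * (s - t).
Proof.
move=> /andP[p1 p2] t0 ts; have s0 := le_trans t0 ts.
have p0 : 0 < p by rewrite (lt_le_trans _ p1).
move: s0; rewrite le_eqVlt => /predU1P[s0|s0].
  have -> : t = s by apply/eqP; rewrite eq_le ts -s0.
  by rewrite !subrr mulr0.
have hs : s `^ (p - 1) <= 1 + s.
  have [s1|/ltW s1] := leP s 1.
    apply: (@le_trans _ _ 1); last lra.
    by rewrite -[leRHS](powRr0 s) ger_powR ?s0 //; lra.
  apply: (@le_trans _ _ s); last lra.
  by rewrite -[leRHS]powRr1 ?(ltW s0) // ler_powR //; lra.
have sp : s `^ p = s * s `^ (p - 1) by rewrite mulr_powRB1 // ltW.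
have sp0 : 0 <= s `^ (p - 1) by exact: powR_ge0.
have r0 : 0 <= t / s by rewrite divr_ge0 // ltW.
have r1 : t / s <= 1 by rewrite ler_pdivrMr // mul1r.
have h : s `^ p * (t / s) ^+ 2 <= t `^ p.
  have Et : t `^ p = s `^ p * (t / s) `^ p.
    by rewrite -powRM ?(ltW s0) // mulrCA mulfV ?mulr1 // gt_eqF.
  rewrite Et ler_wpM2l ?powR_ge0 //.
  move: r0; rewrite le_eqVlt => /predU1P[<-|r0]; first by rewrite expr0n powR_ge0.
  by rewrite -powR_mulrn ?(ltW r0) // ger_powR // r0.
have Est : s - t = s * (1 - t / s).
  by rewrite mulrBr mulr1 mulrCA mulfV ?mulr1 // gt_eqF.
apply: (@le_trans _ _ (s `^ p * (1 - (t / s) ^+ 2))); first by lra.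
rewrite Est sp.
move: (t / s) r0 r1 => r r0 r1.
have -> : s * s `^ (p - 1) * (1 - r ^+ 2) =
  (1 + r) * s `^ (p - 1) * (s * (1 - r)) by ring.
apply: ler_wpM2r; first by rewrite mulr_ge0 ?(ltW s0) //; lra.
by apply: ler_pM => //; lra.
Qed.

Lemma C_l_Lip_powR_excess p (c : R) : 1 <= p <= 2 ->
  C_l_Lip (fun x : R => Num.max (`|x| `^ p - c) 0).
Proof.
move=> p12; exists 2 => //; exists 1%N => x y.
wlog yx : x y / `|y| <= `|x|.
  case: (leP `|y| `|x|) => [h|/ltW h] W; first exact: W.
  by rewrite distrC (distrC x) -addrA (addrC (`|x| ^+ 1)) addrA; exact: W.
have p0 : 0 <= p by case/andP: p12; lra.
have hp : `|y| `^ p <= `|x| `^ p by rewrite ge0_ler_powR ?nnegrE.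
have key := powR_increment_le p12 (normr_ge0 y) yx.
have hd : `|x| - `|y| <= `|x - y| by exact: lerB_dist.
have y0 := normr_ge0 y.
rewrite !expr1; apply: (@le_trans _ _ (`|x| `^ p - `|y| `^ p)).
  rewrite ger0_norm; first by rewrite /Num.max; case: ltP => h1; case: ltP => h2; lra.
  by rewrite subr_ge0 ge_max !le_max lexx orbT andbT lerB.
apply: le_trans key _.
apply: (@le_trans _ _ (2 * (1 + `|x|) * `|x - y|)).
  by apply: ler_wpM2l => //; rewrite mulr_ge0 // addr_ge0.
by apply: ler_wpM2r => //; lra.
Qed.

Lemma max1_powR_le a p q : 0 <= a -> p <= q -> Num.max 1 a `^ p <= 1 + a `^ q.
Proof.
move=> a0 pq; have [a1|/ltW a1] := leP a 1.
  by rewrite powR1 lerDl powR_ge0.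
by apply: (le_trans (ler_powR a1 pq)); rewrite lerDr.
Qed.

(** The threshold [theta^(-1/(q-p))] is where [a^(q-p)] reaches [1 / theta]: above it the first term
    suffices, below it the constant does. *)
Lemma powR_le_small_multiple p q (theta a : R) :
  0 < p -> p < q -> 0 < theta -> 0 <= a ->
  a `^ p <= theta * a `^ q + (theta^-1 `^ (q - p)^-1) `^ p.
Proof.
move=> p0 pq th0 a0; have qp : 0 < q - p by rewrite subr_gt0.
have [h|h] := leP a (theta^-1 `^ (q - p)^-1).
  apply: ler_wpDl; first by rewrite mulr_ge0 ?powR_ge0 // ltW.
  by apply: ge0_ler_powR; rewrite ?nnegrE ?powR_ge0 // ltW.
apply: ler_wpDr; first exact: powR_ge0.
have ap : 0 < a by apply: le_lt_trans h; exact: powR_ge0.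
have -> : q = p + (q - p) by rewrite addrCA subrr addr0.
rewrite powRD; last by rewrite (gt_eqF ap) implybT.
rewrite mulrCA ler_peMr ?powR_ge0 // -ler_pdivrMl // mulr1.
rewrite -[leLHS]powRr1 ?invr_ge0 ?(ltW th0) // -(mulVf (lt0r_neq0 qp)) powRrM.
by apply: ge0_ler_powR; rewrite ?nnegrE ?powR_ge0 // ltW.
Qed.

(** The normalised clipped value [z] lies in [[0, 1]], so [z^e <= z^q]. Since [M >= 1], also
    [z <= M * min(y, 1)], which separates the weight from the variable. *)
Lemma clip_powR_le x a u eta q (e : nat) : 0 < eta -> eta <= 1 -> 0 < u -> 0 <= a ->
  0 < q -> q <= e%:R ->
  (`|clip eta (a / u * x)| / eta) ^+ e <=
  (Num.max 1 a / eta) `^ q * Num.min ((`|x| / u) `^ q) 1.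
Proof.
move=> eta0 eta1 u0 a0 q0 qe.
set z := _ / eta; set M := _ / eta; set y := `|x| / u.
have z0 : 0 <= z by rewrite divr_ge0 // ltW.
have z1 : z <= 1 by rewrite ler_pdivrMr // mul1r clip_norm_le // ltW.
have y0 : 0 <= y by rewrite divr_ge0 // ltW.
have M1 : 1 <= M by rewrite ler_pdivlMr // mul1r (le_trans eta1) // le_max lexx.
have M0 : 0 <= M by rewrite (le_trans _ M1).
have zM : z <= M * Num.min y 1.
  have [y1|y1] := leP y 1; last by rewrite mulr1 (le_trans z1).
  have [h|/ltW h] := leP `|a / u * x| eta.
    rewrite /z clip_id // /M [leRHS]mulrAC ler_pM2r ?invr_gt0 //.
    rewrite normrM ger0_norm ?divr_ge0 ?(ltW u0) // -mulrA [u^-1 * _]mulrC.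
    by rewrite ler_wpM2r // le_max lexx orbT.
  rewrite /z clip_norm_ge ?(ltW eta0) // mulfV ?gt_eqF //.
  rewrite /M [leRHS]mulrAC ler_pdivlMr // mul1r (le_trans h) //.
  rewrite normrM ger0_norm ?divr_ge0 ?(ltW u0) // -mulrA [u^-1 * _]mulrC.
  by rewrite ler_wpM2r // le_max lexx orbT.
apply: (@le_trans _ _ (z `^ q)).
  move: z0; rewrite le_eqVlt => /predU1P[<-|z0].
    have e0 : (0 < e)%N by rewrite -(ltr_nat R) (lt_le_trans q0).
    by rewrite expr0n gtn_eqF // powR_ge0.
  by rewrite -powR_mulrn ?(ltW z0) // ger_powR // z0.
apply: (@le_trans _ _ ((M * Num.min y 1) `^ q)).
  apply: ge0_ler_powR => //; rewrite ?nnegrE ?(ltW q0) // mulr_ge0 //.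
  by rewrite le_min y0 ler01.
rewrite powRM //; last by rewrite le_min y0 ler01.
rewrite ler_wpM2l ?powR_ge0 //.
have [y1|/ltW y1] := leP y 1.
  rewrite le_min lexx /= -[leRHS](_ : 1 `^ q = 1); last by rewrite powR1.
  by apply: ge0_ler_powR; rewrite ?nnegrE // ltW.
rewrite powR1 le_min lexx andbT -[leLHS](_ : 1 `^ q = 1); last by rewrite powR1.
by apply: ge0_ler_powR; rewrite ?nnegrE // ltW.
Qed.

(** Clipping adds at most [max(c|x| - eta, 0)]. If [z = c|x| / eta > 1], then [z <= z^p], and the
    smallness condition makes the excess term at least [eta (2 z - 1)]. Under expectation the linear
    part is removed by centring. *)
Lemma clip_le_linear_excess x (c : R) eta p (c0 : R) :
  0 <= c -> 0 < eta -> 1 <= p -> 2 * c0 * (c / eta) `^ p <= 1 ->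
  clip eta (c * x) <=
    c * x + 2 * eta * (c / eta) `^ p * Num.max (`|x| `^ p - c0) 0.
Proof.
move=> cn eta0 p1 hc; apply: le_trans (clip_le_add _ (ltW eta0)) _.
rewrite lerD2l; set D := (c / eta) `^ p.
have D0 : 0 <= D by exact: powR_ge0.
have mul0 : 0 <= 2 * eta * D by rewrite !mulr_ge0 // ltW.
rewrite ge_max mulr_ge0 //= ?le_max ?lexx ?orbT // andbT.
rewrite normrM (ger0_norm cn).
have [h|h] := leP (c * `|x|) eta.
  apply: (@le_trans _ _ 0); first by rewrite subr_le0.
  by rewrite mulr_ge0 // le_max lexx orbT.
have z1 : 1 <= c / eta * `|x| by rewrite mulrAC ler_pdivlMr // mul1r ltW.
have hz := le1r_powR z1 p1.
rewrite powRM ?divr_ge0 ?(ltW eta0) // -/D in hz.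
apply: (@le_trans _ _ (2 * eta * D * (`|x| `^ p - c0))); last first.
  by rewrite ler_wpM2l // le_max lexx.
have -> : c * `|x| = eta * (c / eta * `|x|) by field; rewrite gt_eqF.
move: (c / eta * `|x|) (`|x| `^ p) z1 hz => z y z1 hz.
have h1 : eta * z <= eta * (D * y) by rewrite ler_pM2l.
have h2 : eta * (2 * c0 * D) <= eta * 1 by rewrite ler_pM2l.
have h3 : 0 <= eta * z by rewrite mulr_ge0 ?ltW //; lra.
have -> : 2 * eta * D * (y - c0) = 2 * (eta * (D * y)) - eta * (2 * c0 * D) by ring.
by lra.
Qed.

End PowerBounds.

(** * The one-sided series for weighted sums *)

Section OneSided.
Variables (R : realType) (d : measure_display) (Omega : measurableType d).
Variables (H : set (Omega -> R)) (E : (Omega -> R) -> \bar R).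
Variables (X : Omega -> R) (Xn : nat -> Omega -> R).
Variables (p q : R) (l : R -> R) (a : nat -> nat -> R).
Hypotheses (hH : random_variable_space H) (hE : sublinear_expectation H E).
Hypothesis hp : 0 < p < 2.
Hypotheses (hX : H X) (hXn : forall n, (1 <= n)%N -> H (Xn n)).
Hypothesis hid : forall n, (1 <= n)%N -> identically_distributed E (Xn n) X.
Hypothesis hq : p < q.
Hypothesis ha : forall n i, (1 <= i <= n)%N -> 0 <= a n i.
Variable C : R.
Hypothesis C0 : 0 < C.
Hypothesis haq : forall n, (1 <= n)%N -> \sum_(1 <= i < n.+1) a n i `^ q <= C * n%:R.

Let normalizer (n : nat) : R := n%:R `^ p^-1.

Let p0 : 0 < p. Proof. by case/andP: hp. Qed.

Let iotaP n i : i \in index_iota 1 n.+1 -> (1 <= i <= n)%N.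
Proof. by rewrite mem_index_iota ltnS. Qed.

Lemma normalizer_gt0 n : (1 <= n)%N -> 0 < normalizer n.
Proof. by move=> n1; rewrite powR_gt0 // ltr0n. Qed.

Lemma normalizer_powR n : normalizer n `^ p = n%:R.
Proof. by rewrite /normalizer -powRrM mulVf ?gt_eqF // powRr1. Qed.

Lemma sum_max1_powR_le (s : R) (n : nat) : (1 <= n)%N -> s <= q ->
  \sum_(1 <= i < n.+1) Num.max 1 (a n i) `^ s <= (1 + C) * n%:R.
Proof.
move=> n1 sq; apply: (@le_trans _ _ (\sum_(1 <= i < n.+1) (1 + a n i `^ q))).
  rewrite !big_seq; apply: ler_sum => i /iotaP hi.
  by apply: max1_powR_le => //; exact: ha.
rewrite big_split /= big_const_nat subSS subn0 iter_addr_0 mulrDl mul1r.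
by rewrite lerD2l haq.
Qed.

Lemma capacity_weighted_sumE (n : nat) (eps : R) : (1 <= n)%N ->
  [set w | eps * normalizer n < \sum_(1 <= i < n.+1) a n i * Xn i w] =
  [set w | eps < \sum_(1 <= i < n.+1) a n i / normalizer n * Xn i w].
Proof.
move=> n1; apply/funext => w /=; rewrite -ltr_pdivlMr ?normalizer_gt0 // mulr_suml.
by under [in LHS]eq_bigr do rewrite mulrAC.
Qed.

(** The majorant [F] is tied to [X] pointwise and need not be a function of it, so the law is
    transferred from [Xn i] to [X] before comparing. *)
Lemma sle_le_majorant (i : nat) (f : R -> R) (F : Omega -> R) (kap W : R) :
  (1 <= i)%N -> C_b_Lip f -> H F -> 0 <= kap -> (E F <= W%:E)%E ->
  (forall w, f (X w) <= kap * F w) ->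
  (E (fun w => f (Xn i w)) <= (kap * W)%:E)%E.
Proof.
move=> i1 hf HF kap0 EF fF.
have -> : E (fun w => f (Xn i w)) = E (fun w => f (X w)).
  exact: (sle_identically_distributed hH hE (hXn i1) hX (hid i1) hf).
apply: (@le_trans _ _ (E (fun w => kap * F w))).
  apply: (sle_mono hE) => //; first exact: (rvs_scale hH).
  by apply: (rvs_comp1 hH) => //; exact: C_b_Lip_l.
exact: (sle_scale_le hE).
Qed.

Section Bound.
Variables (n : nat) (F : Omega -> R) (W q1 eps : R).
Hypotheses (n1 : (1 <= n)%N) (HF : H F) (EF : (E F <= W%:E)%E) (W0 : 0 < W).
Hypothesis hF : forall w, Num.min ((`|X w| / normalizer n) `^ q1) 1 <= F w.
Hypotheses (q10 : 0 < q1) (q1q : q1 <= q) (eps0 : 0 < eps).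

Lemma capacity_weighted_sum_le_L1 : q1 <= 1 ->
  (capacity H E [set w | (eps * normalizer n < \sum_(1 <= i < n.+1) a n i * Xn i w)%R]
   <= ((1 + eps^-1) * (1 + C) * (n%:R * W))%:E)%E.
Proof.
move=> q11; rewrite capacity_weighted_sumE //.
have c0 i : i \in index_iota 1 n.+1 -> 0 <= a n i / normalizer n.
  by move=> /iotaP /ha h; rewrite divr_ge0 // ltW // normalizer_gt0.
have := @capacity_sum_gt_L1 _ _ _ _ _ hH hE _ (index_iota 1 n.+1) Xn
  (fun i => a n i / normalizer n) (fun i => Num.max 1 (a n i) `^ q1 * W) _ eps0.
move=> /(_ _ c0) h; apply: le_trans (h _ _) _.
- by move=> i /iotaP /andP[i1 _]; exact: hXn.
- move=> i si; have /andP[i1 _] := iotaP si.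
  apply: (sle_le_majorant (F := F)
    (f := fun x => `|clip 1 (a n i / normalizer n * x)|)) => //.
  + exact/C_b_Lip_norm/C_b_Lip_clip/ltr01/c0.
  + exact: powR_ge0.
  move=> w; apply: (@le_trans _ _ (Num.max 1 (a n i) `^ q1 *
      Num.min ((`|X w| / normalizer n) `^ q1) 1)); last by rewrite ler_wpM2l ?powR_ge0.
  have := @clip_powR_le R (X w) (a n i) (normalizer n) 1 q1 1 ltr01 (lexx _)
    (normalizer_gt0 n1) (ha (iotaP si)) q10 q11.
  by rewrite expr1 !divr1.
- rewrite lee_fin -mulr_suml -!mulrA ler_wpM2l //.
    by rewrite addr_ge0 // invr_ge0 ltW.
  by rewrite mulrA ler_pM2r // sum_max1_powR_le.
Qed.

Lemma capacity_weighted_sum_le_END (K eta c0 delta : R) :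
  1 <= K ->
  (forall f : nat -> R -> R,
      (forall i, (1 <= i)%N ->
        [/\ C_b_Lip (f i), (forall x, 0 <= f i x) & {homo f i : x y / x <= y}]) ->
      forall n, (1 <= n)%N ->
        (E (fun w => \prod_(1 <= i < n.+1) f i (Xn i w))%R <=
        K%:E * \prod_(1 <= i < n.+1) E (f i \o Xn i))%E) ->
  1 <= p -> q1 <= 2 -> (E X <= 0)%E -> 0 < eta -> eta <= eps / 8 -> eta <= 1 ->
  0 < delta -> 4 * eta * delta * eta^-1 `^ p * (1 + C) <= eps ->
  (E (fun w => Num.max (`|X w| `^ p - c0) 0)%R <= delta%:E)%E ->
  (forall i, (1 <= i <= n)%N -> 2 * c0 * (a n i / normalizer n / eta) `^ p <= 1) ->
  (capacity H E [set w | (eps * normalizer n < \sum_(1 <= i < n.+1) a n i * Xn i w)%R]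
   <= ((1 + K * expR 1) * (eta^-1 `^ q1 * (1 + C)) * (n%:R * W))%:E)%E.
Proof.
move=> K1 hEND p1 q12 EX eta0 eta8 eta1 del0 heps hexc hsmall.
rewrite capacity_weighted_sumE //.
have sn := normalizer_gt0 n1.
have cge0 i : (1 <= i <= n)%N -> 0 <= a n i / normalizer n.
  by move=> /ha h; rewrite divr_ge0 // ltW.
have n0 : 0 < n%:R :> R by rewrite ltr0n.
have C10 : 0 < 1 + C by rewrite addr_gt0.
have etaV0 : 0 < eta^-1 by rewrite invr_gt0.
pose r := eta^-1 `^ q1 * (1 + C) * (n%:R * W).
have r0 : 0 < r by rewrite !mulr_gt0 // powR_gt0.
rewrite -[X in (_ <= X%:E)%E]mulrA -/r.
(* The mean bounds come from [clip_le_linear_excess] and [E X <= 0], the second-moment bounds from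
   [clip_powR_le] with exponent 2. *)
apply: (@capacity_sum_gt_END _ _ _ _ _ hH hE Xn K K1 hXn hEND n
  (fun i => a n i / normalizer n)
  (fun i => 2 * eta * (a n i / normalizer n / eta) `^ p * delta)
  (fun i => (Num.max 1 (a n i) / eta) `^ q1 * W) eta eps r) => //.
- move=> i hi; have /andP[i1 _] := hi.
  pose f x := clip eta (a n i / normalizer n * x).
  have -> : E (fun w => clip eta (a n i / normalizer n * Xn i w)) = E (f \o X).
    apply: (sle_identically_distributed hH hE (hXn i1) hX (hid i1)).
    exact/C_b_Lip_clip/eta0/cge0.
  have HG : H (fun w => Num.max (`|X w| `^ p - c0) 0).
    apply: (rvs_comp1 hH (phi := fun x => Num.max (`|x| `^ p - c0) 0)) => //.
    by apply: C_l_Lip_powR_excess; rewrite p1 ltW //; case/andP: hp.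
  have D0 : 0 <= 2 * eta * (a n i / normalizer n / eta) `^ p.
    by rewrite mulr_ge0 ?powR_ge0 // mulr_ge0 // ltW.
  apply: (@le_trans _ _ (E (fun w => a n i / normalizer n * X w +
      2 * eta * (a n i / normalizer n / eta) `^ p * Num.max (`|X w| `^ p - c0) 0))).
    apply: (sle_mono hE).
    + by apply: (rvs_add hH); exact: (rvs_scale hH).
    + apply: (rvs_comp1 hH (phi := f)) => //.
      exact/C_b_Lip_l/C_b_Lip_clip/eta0/cge0.
    + move=> w; apply: clip_le_linear_excess => //; first exact: cge0.
      exact: hsmall.
  rewrite -[X in (_ <= X%:E)%E]add0r; apply: (sle_add_le hE).
  + exact: (rvs_scale hH).
  + exact: (rvs_scale hH).
  + by rewrite -[X in (_ <= X%:E)%E](mulr0 (a n i / normalizer n));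
      apply: (sle_scale_le hE) => //; exact: cge0.
  + exact: (sle_scale_le hE).
- move=> i hi; have /andP[i1 _] := hi; rewrite mulrA.
  apply: (sle_le_majorant (F := F)
    (f := fun x => clip eta (a n i / normalizer n * x) ^+ 2)) => //.
  + exact/C_b_Lip_sqr/C_b_Lip_clip/eta0/cge0.
  + by rewrite mulr_ge0 ?sqr_ge0 ?powR_ge0.
  move=> w; have := @clip_powR_le R (X w) (a n i) (normalizer n) eta q1 2 eta0 eta1
    sn (ha hi) q10 q12.
  rewrite expr_div_n real_normK ?num_real // ler_pdivrMr ?exprn_gt0 // => h.
  apply: (le_trans h); rewrite mulrC mulrA ler_wpM2l //.
  by apply: mulr_ge0; [exact: sqr_ge0 | exact: powR_ge0].
- rewrite -mulr_suml -mulr_sumr.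
  (* The normalizer contributes [1 / n] to each summand, which cancels the linear growth of the
     weight sums; the clipped means then total at most [eps / 2] by the choice of [delta]. *)
  have h : \sum_(1 <= i < n.+1) (a n i / normalizer n / eta) `^ p <=
      eta^-1 `^ p * (1 + C).
    apply: (@le_trans _ _ (\sum_(1 <= i < n.+1)
        Num.max 1 (a n i) `^ p * (n%:R^-1 * eta^-1 `^ p))).
      rewrite !big_seq; apply: ler_sum => i /iotaP hi.
      rewrite powRM ?cge0 ?(ltW etaV0) // powRM ?ha ?invr_ge0 ?(ltW sn) //.
      have -> : (normalizer n)^-1 `^ p = n%:R^-1.
        by rewrite -powR_inv1 ?(ltW sn) // -powRrM mulN1r powRN normalizer_powR.
      rewrite -mulrA ler_wpM2r ?mulr_ge0 ?invr_ge0 ?powR_ge0 ?(ltW n0) //.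
      apply: ge0_ler_powR; rewrite ?nnegrE ?ha ?(ltW p0) //.
        by rewrite le_max ler01.
      by rewrite le_max lexx orbT.
    rewrite -mulr_suml mulrA mulrC ler_wpM2l ?powR_ge0 // ler_pdivrMr //.
    by apply: sum_max1_powR_le => //; exact: ltW.
  have D0 : 0 <= 2 * eta * delta by rewrite !mulr_ge0 // ltW.
  have := ler_wpM2l D0 h; lra.
- rewrite -mulr_suml /r mulrA ler_pM2r //.
  rewrite (eq_big_nat _ _ (F2 := fun i => Num.max 1 (a n i) `^ q1 * eta^-1 `^ q1)).
    rewrite -mulr_suml mulrC -mulrA ler_wpM2l ?powR_ge0 //.
    exact: sum_max1_powR_le.
  by move=> i _; rewrite powRM ?(ltW etaV0) // le_max ler01.
Qed.

End Bound.

Hypothesis hl : slowly_varying l.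
Hypothesis hEND : upper_END E Xn.
Hypothesis hcenter : 1 <= p -> (E X <= 0)%E /\
  E (fun w => Num.max (`|X w| `^ p - c) 0) @[c --> +oo%R] --> 0%E.
Hypothesis hC :
  (choquet H E (fun w => `|X w| `^ p * l (`|X w| `^ p))%R < +oo)%E.

(* For large n each single weight is o(n^(1/p)), because a^q <= C n. *)
Lemma eventually_small_weights (c0 eta : R) : 0 <= c0 -> 0 < eta ->
  exists n0 : nat, forall n i, (n0 <= n)%N -> (1 <= i <= n)%N ->
    2 * c0 * (a n i / normalizer n / eta) `^ p <= 1.
Proof.
move=> c00 eta0; have etaV0 : 0 <= eta^-1 by rewrite invr_ge0 ltW.
pose G := 2 * c0 * eta^-1 `^ p.
have G0 : 0 <= G by rewrite !mulr_ge0 // powR_ge0.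
(* Chosen so that [(G + 1) * theta * C * n = n / 2]; the added 1 covers [G = 0]. The other half of
   [n] absorbs [G * T] once [n >= 2 G T]. *)
pose theta := (2 * C * (G + 1))^-1.
have GC : 0 < 2 * C * (G + 1) by rewrite !mulr_gt0 //; lra.
have th0 : 0 < theta by rewrite invr_gt0.
pose T := (theta^-1 `^ (q - p)^-1) `^ p.
have T0 : 0 <= T by exact: powR_ge0.
have GT0 : 0 <= 2 * G * T by apply: mulr_ge0 => //; exact: mulr_ge0.
have /andP[_ hn0] := truncn_itv GT0.
exists (Num.truncn (2 * G * T)).+1 => n i n0n hi; have /andP[i1 iN] := hi.
have n1 := leq_trans i1 iN.
have sn := normalizer_gt0 n1; have a0 := ha hi.
have n0 : 0 < n%:R :> R by rewrite ltr0n.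
have hn : 2 * G * T <= n%:R.
  by apply: le_trans (ltW hn0) _; rewrite ler_nat.
have -> : 2 * c0 * (a n i / normalizer n / eta) `^ p = G * a n i `^ p / n%:R.
  rewrite powRM ?divr_ge0 ?(ltW sn) // powRM ?invr_ge0 ?(ltW sn) //.
  have -> : (normalizer n)^-1 `^ p = n%:R^-1.
    by rewrite -powR_inv1 ?(ltW sn) // -powRrM mulN1r powRN normalizer_powR.
  by rewrite /G; ring.
rewrite ler_pdivrMr // mul1r.
have aq : a n i `^ q <= C * n%:R.
  apply: le_trans (haq n1); rewrite (big_rem i) /=; last by rewrite mem_index_iota ltnS.
  by rewrite lerDl sumr_ge0 // => j _; exact: powR_ge0.
have hap := powR_le_small_multiple p0 hq th0 a0; rewrite -/T in hap.
have h1 : theta * a n i `^ q <= theta * (C * n%:R) by rewrite ler_wpM2l // ltW.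
have h2 : G * a n i `^ p <= G * (theta * (C * n%:R) + T).
  by rewrite ler_wpM2l // (le_trans hap) // lerD2r.
have h3 : (G + 1) * (theta * (C * n%:R)) = n%:R / 2.
  by rewrite /theta; field; apply/andP; split; rewrite gt_eqF //; lra.
have h4 : 0 <= theta * (C * n%:R) by rewrite !mulr_ge0 // ltW.
lra.
Qed.

Lemma one_sided_complete_convergence (eps : R) : 0 < eps ->
  (\sum_(1 <= n <oo) (n%:R^-1 * l n%:R)%R%:E *
     capacity H E [set w | (eps * n%:R `^ p^-1 <
                            \sum_(1 <= i < n.+1) a n i * Xn i w)%R]
   < +oo)%E.
Proof.
move=> eps0; have [l_gt0 _ _] := hl.
(* The order of the moment used: first when [p < 1], second otherwise. In both cases [p < e], so
   [q1] can be put strictly above [p]. *)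
pose e : nat := if p < 1 then 1 else 2.
have pe : p < e%:R by rewrite /e; case: ifP => // _; case/andP: hp.
pose q1 := Num.min q e%:R.
have pq1 : p < q1 by rewrite lt_min hq pe.
have q10 : 0 < q1 by exact: lt_trans pq1.
have q1q : q1 <= q by rewrite ge_min lexx.
have q1e : q1 <= e%:R by rewrite ge_min lexx orbT.
pose rho := q1 / p.
have rho1 : 1 < rho by rewrite ltr_pdivlMr // mul1r.
have U0 w : 0 <= `|X w| `^ p by exact: powR_ge0.
have [F [W [k1 [B [hFW hUF hl4 hB]]]]] :=
  truncated_powR_majorants hH hE rho1 hl U0 hC.
(* Indeed [(|X| / u_n)^q1 = (|X|^p / n)^rho], which decreases with [n], so one majorant serves a
   whole dyadic block. *)
have layer k n w : (2 ^ k <= n)%N -> Num.min ((`|X w| / normalizer n) `^ q1) 1 <= F k w.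
  move=> kn; apply: le_trans (hUF k w).
  have n1 : (1 <= n)%N by apply: leq_trans kn; rewrite expn_gt0.
  have sn := normalizer_gt0 n1.
  rewrite le_min !ge_min lexx orbT andbT; apply/orP; left.
  have -> : q1 = p * rho by rewrite /rho mulrCA mulfV ?mulr1 // gt_eqF.
  have p2 : 0 < 2 ^+ k :> R by rewrite exprn_gt0.
  rewrite powRrM; apply: ge0_ler_powR; rewrite ?nnegrE ?powR_ge0 //.
    exact/ltW/(lt_trans _ rho1).
  rewrite powRM ?invr_ge0 ?(ltW sn) //.
  have -> : (normalizer n)^-1 `^ p = n%:R^-1.
    by rewrite -powR_inv1 ?(ltW sn) // -powRrM mulN1r powRN normalizer_powR.
  rewrite ler_wpM2l // lef_pV2 ?posrE ?ltr0n //.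
  by rewrite -natrX ler_nat.
(* The factor [n] cancels the weight [1 / n], and [l n <= 4 l (2^k)] on the block, so each term is
   at most [4 D l(2^k) W_k], whose block sums are bounded by [hB]. *)
suff [D [k2 [D0 hD]]] : exists (D : R) (k2 : nat), 0 <= D /\
    forall k n, (k2 <= k)%N -> (2 ^ k <= n < 2 ^ k.+1)%N ->
    (capacity H E [set w | (eps * normalizer n < \sum_(1 <= i < n.+1) a n i * Xn i w)%R]
     <= (D * (n%:R * W k))%:E)%E.
  have W0 k : 0 < W k by have [] := hFW k.
  have lk k : 0 < l (2 ^+ k) by apply: l_gt0; rewrite exprn_gt0.
  have V0 n := capacity_ge0 hH hE
    [set w | (eps * n%:R `^ p^-1 < \sum_(1 <= i < n.+1) a n i * Xn i w)%R].
  have c0 n : (1 <= n)%N -> 0 < n%:R^-1 * l n%:R.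
    by move=> n1; rewrite mulr_gt0 ?invr_gt0 ?l_gt0 ?ltr0n.
  apply: (@nneseries_dyadic_lty _ _ (fun n => n%:R^-1 * l n%:R)
    (fun k => 4 * D * (l (2 ^+ k) * W k)) (maxn k1 k2) (4 * D * B)).
  - move=> n n1; have cn := c0 n n1.
    rewrite mule_ge0 ?lee_fin ?(ltW cn) //= -[leRHS]mule1 lee_pmul2l //.
    exact: (capacity_le1 hH hE).
  - move=> k n; rewrite geq_max => /andP[k1k k2k] hkn; have /andP[kn nk] := hkn.
    have n1 : (1 <= n)%N by apply: leq_trans kn; rewrite expn_gt0.
    have n0 : 0 < n%:R :> R by rewrite ltr0n.
    apply: (@le_trans _ _ ((n%:R^-1 * l n%:R)%:E * (D * (n%:R * W k))%:E)%E).
      by rewrite lee_pmul2l ?lte_fin ?c0 //; exact: hD.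
    rewrite -EFinM lee_fin.
    have -> : n%:R^-1 * l n%:R * (D * (n%:R * W k)) = D * W k * l n%:R.
      by field; rewrite gt_eqF.
    have -> : 4 * D * (l (2 ^+ k) * W k) = D * W k * (4 * l (2 ^+ k)) by ring.
    apply: ler_wpM2l; first by rewrite mulr_ge0 // ltW.
    apply: hl4 => //; rewrite -!natrX !ler_nat kn /=; exact: ltnW.
  - move=> N.
    have -> : \sum_(maxn k1 k2 <= k < N) 2 ^+ k * (4 * D * (l (2 ^+ k) * W k)) =
        4 * D * \sum_(maxn k1 k2 <= k < N) 2 ^+ k * l (2 ^+ k) * W k.
      by rewrite mulr_sumr; apply: eq_bigr => k _; ring.
    have Z0 k : 0 <= 2 ^+ k * l (2 ^+ k) * W k.
      by apply: mulr_ge0; [apply: mulr_ge0; [exact: exprn_ge0|]|]; exact: ltW.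
    apply: ler_wpM2l; first by rewrite mulr_ge0.
    apply: le_trans (hB N).
    have [kN|kN] := leqP (maxn k1 k2) N; last first.
      by rewrite big_geq ?sumr_ge0 //; exact: ltnW.
    rewrite [leRHS](@big_cat_nat _ _ _ (maxn k1 k2)) ?leq_maxl //=.
    by rewrite lerDr sumr_ge0.
have C10 : 0 < 1 + C by rewrite addr_gt0.
have [p1|p1] := ltP p 1.
  exists ((1 + eps^-1) * (1 + C)), 0%N; split.
    by apply: mulr_ge0; [rewrite addr_ge0 // invr_ge0|]; exact: ltW.
  move=> k n _ /andP[kn _]; have [HF W0 EF] := hFW k.
  apply: (capacity_weighted_sum_le_L1 _ HF EF W0 _ q10 q1q eps0).
  - by apply: leq_trans kn; rewrite expn_gt0.
  - by move=> w; exact: layer.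
  - by rewrite /e p1 in q1e.
have [EX hlim] := hcenter p1.
have [K K1 hK] := hEND.
(* The Chernoff bound asks for [eta <= eps / 8], the moment comparison for [eta <= 1]; [delta] then
   turns the condition on the means into an equality. *)
pose eta := Num.min (eps / 8) 1.
have eta0 : 0 < eta by rewrite lt_min ltr01 andbT divr_gt0.
have etaV0 : 0 < eta^-1 by rewrite invr_gt0.
have ep0 : 0 < eta^-1 `^ p by rewrite powR_gt0.
pose delta := eps / (4 * eta * eta^-1 `^ p * (1 + C)).
have del0 : 0 < delta by rewrite divr_gt0 // !mulr_gt0.
have [M [_ hM]] := cvge0_lt hlim del0.
(* The limit at infinity gives its bound strictly beyond [M], hence the added 1; the maximum ensures
   [c0 >= 0]. *)
pose c0 := Num.max M 0 + 1.
have c00 : 0 <= c0 by rewrite addr_ge0 // le_max lexx orbT.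
have Mc0 : M < c0 by rewrite ltr_pwDr // le_max lexx.
have [n0 hn0] := eventually_small_weights c00 eta0.
exists ((1 + K * expR 1) * (eta^-1 `^ q1 * (1 + C))), n0; split.
  rewrite mulr_ge0 //; last by rewrite mulr_ge0 ?powR_ge0 // ltW.
  by rewrite addr_ge0 // mulr_ge0 ?expR_ge0 // (le_trans ler01).
move=> k n n0k /andP[kn _]; have [HF W0 EF] := hFW k.
apply: (capacity_weighted_sum_le_END (c0 := c0) (delta := delta)
  _ HF EF W0 _ q10 q1q K1 hK p1 _ EX eta0 _ _ del0).
- by apply: leq_trans kn; rewrite expn_gt0.
- by move=> w; exact: layer.
- by rewrite /e ltNge p1 in q1e.
- by rewrite ge_min lexx.
- by rewrite ge_min lexx orbT.
- rewrite /delta le_eqVlt; apply/orP; left; apply/eqP; field.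
  by rewrite !gt_eqF.
- exact/ltW/hM.
- move=> i hi; apply: hn0 => //; apply: leq_trans n0k _.
  by apply: leq_trans kn; exact/ltnW/ltn_expl.
Qed.

End OneSided.

(** * Negated variables and the two-sided conclusion *)

Section Negation.
Variables (R : realType) (d : measure_display) (Omega : measurableType d).
Variable E : (Omega -> R) -> \bar R.

Lemma C_l_Lip_opp (phi : R -> R) : C_l_Lip phi -> C_l_Lip (fun x => phi (- x)).
Proof.
move=> [C C0 [m h]]; exists C => //; exists m => x y.
apply: le_trans (h _ _) _.
by rewrite !normrN -opprD normrN.
Qed.

Lemma identically_distributed_opp (X Y : Omega -> R) :
  identically_distributed E X Y ->
  identically_distributed E (fun w => - X w) (fun w => - Y w).
Proof. by move=> XY phi /C_l_Lip_opp /XY. Qed.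

(** Reflection [x -> f (- x)] exchanges non-decreasing and non-increasing test functions while
    keeping bounds and Lipschitz constants. *)
Lemma upper_END_opp (X : nat -> Omega -> R) :
  lower_END E X -> upper_END E (fun n w => - X n w).
Proof.
move=> [K K1 h]; exists K => // f hf n n1.
apply: (h (fun i x => f i (- x))) => // i /hf [[C C0 [fC fL]] f0 f_nd].
split=> // [|x y xy]; last by apply: f_nd; rewrite lerN2.
exists C => //; split=> // x y; apply: le_trans (fL _ _) _.
by rewrite -opprD normrN.
Qed.

End Negation.

Theorem theorem2p5 (R : realType) (d : measure_display)
    (Omega : measurableType d)
    (H : set (Omega -> R)) (E : (Omega -> R) -> \bar R)
    (X : Omega -> R) (Xn : nat -> Omega -> R)
    (p q : R) (l : R -> R) (a : nat -> nat -> R)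
    (hH : random_variable_space H) (hE : sublinear_expectation H E)
    (hp : 0 < p < 2)
    (hX : H X) (hXn : forall n, (1 <= n)%N -> H (Xn n))
    (hid : forall n, (1 <= n)%N -> identically_distributed E (Xn n) X)
    (hEND : extended_negatively_dependent E Xn)
    (hcenter : 1 <= p -> E X = 0%E /\
       E (fun w => Num.max (`|X w| `^ p - c) 0) @[c --> +oo%R] --> 0%E)
    (hl : slowly_varying l)
    (ha : forall n i, (1 <= i <= n)%N -> 0 <= a n i)
    (hq : p < q)
    (haq : exists2 C : R, 0 < C & forall n, (1 <= n)%N ->
       \sum_(1 <= i < n.+1) a n i `^ q <= C * n%:R)
    (hC : (choquet H E (fun w => `|X w| `^ p * l (`|X w| `^ p))%R < +oo)%E) :
  (forall eps : R, 0 < eps ->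
     (\sum_(1 <= n <oo) (n%:R^-1 * l n%:R)%R%:E *
        capacity H E [set w | (eps * n%:R `^ p^-1 <
                               \sum_(1 <= i < n.+1) a n i * Xn i w)%R]
      < +oo)%E) /\
  ((1 <= p -> conj_expectation E X = 0%E) ->
   forall eps : R, 0 < eps ->
     (\sum_(1 <= n <oo) (n%:R^-1 * l n%:R)%R%:E *
        capacity H E [set w | (eps * n%:R `^ p^-1 <
                               `|\sum_(1 <= i < n.+1) a n i * Xn i w|)%R]
      < +oo)%E).
Proof.
have [C C0 hCn] := haq; have [hup hlow] := hEND.
have centered : 1 <= p -> (E X <= 0)%E /\
    E (fun w => Num.max (`|X w| `^ p - c) 0) @[c --> +oo%R] --> 0%E.
  by move=> /hcenter [-> ?].
have upper eps : 0 < eps -> (\sum_(1 <= n <oo) (n%:R^-1 * l n%:R)%R%:E *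
    capacity H E [set w | (eps * n%:R `^ p^-1 <
                           \sum_(1 <= i < n.+1) a n i * Xn i w)%R] < +oo)%E.
  exact: (one_sided_complete_convergence hH hE hp hX hXn hid hq ha C0 hCn).
split=> // hconj eps eps0.
have HN Y : H Y -> H (fun w => - Y w).
  by move=> HY; under eq_fun do rewrite -mulN1r; exact: (rvs_scale hH).
have centeredN : 1 <= p -> (E (fun w => (- X w)%R) <= 0)%E /\
    E (fun w => Num.max (`|- X w| `^ p - c) 0) @[c --> +oo%R] --> 0%E.
  move=> p1; split; first by have /eqP := hconj p1; rewrite oppe_eq0 => /eqP ->.
  have EN c : E (fun w => Num.max (`|- X w| `^ p - c) 0) =
      E (fun w => Num.max (`|X w| `^ p - c) 0).
    by congr E; apply/funext => w; rewrite normrN.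
  by under eq_fun do rewrite EN; case: (hcenter p1).
have hCN : (choquet H E (fun w => `|- X w| `^ p * l (`|- X w| `^ p))%R < +oo)%E.
  by under eq_fun do rewrite normrN.
have lower := one_sided_complete_convergence hH hE hp (HN _ hX)
  (fun n n1 => HN _ (hXn n n1)) (fun n n1 => identically_distributed_opp (hid n n1))
  hq ha C0 hCn hl (upper_END_opp hlow) centeredN hCN eps0.
have [l_gt0 _ _] := hl.
(* At [n = 0] the inverse is 0 by convention, so the sign of [l 0] is irrelevant. *)
have c0 n : (0 <= (n%:R^-1 * l n%:R)%:E)%E.
  rewrite lee_fin; case: n => [|n]; first by rewrite invr0 mul0r.
  by rewrite mulr_ge0 ?invr_ge0 // ltW // l_gt0 // ltr0n.
have V0 A : (0 <= capacity H E A)%E by exact: capacity_ge0.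
(* The two-sided event is the union of the one-sided events for the sum and its negation;
   subadditivity of the capacity compares the series term by term. *)
apply: le_lt_trans (lte_add_pinfty (upper eps eps0) lower).
rewrite -nneseriesD; last 2 first.
- by move=> n n1 _; rewrite mule_ge0 ?c0.
- by move=> n n1 _; rewrite mule_ge0 ?c0.
apply: lee_nneseries => n n1; first by rewrite mule_ge0 ?c0.
rewrite -ge0_muleDr //; apply: lee_wpmul2l; first exact: c0.
apply: le_trans (capacityU hH hE _ _).
apply: le_capacity => w /=; rewrite ltr_normr => /orP[h|h]; [left|right] => //=.
by under eq_bigr do rewrite mulrN; rewrite sumrN.
Qed.
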